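(* The energy profile curve $E:[2\pi,\infty)\to[0,\infty)$, $$E(\ell)=\inf\bigl\{\mathcal E(\gamma)\mid \gamma\in W^{2,2}_{\mathrm{Imm}}(\mathbb S^1,\mathbb R^2),\ n_\gamma=1,\ \mathcal A(\gamma)=\pi,\ \mathcal L(\gamma)=\ell\bigr\},$$ is continuous on $[2\pi,\infty)$, and $E(\ell)\to0$ as $\ell\to\infty$.
   Context: $\mathbb S^1=\mathbb R/2\pi\mathbb Z$. $W^{2,2}_{\mathrm{Imm}}(\mathbb S^1,\mathbb R^2)$ is the set of $\gamma\in W^{2,2}(\mathbb S^1,\mathbb R^2)$ with $\partial_x\gamma(x)\ne0$ for all $x$. For such $\gamma$ write $ds=|\partial_x\gamma|\,dx$, $\partial_s=\partial_x/|\partial_x\gamma|$, $\tau=\partial_s\gamma=(\tau_1,\tau_2)$, $\nu=(-\tau_2,\tau_1)$, $\kappa$ defined by $\partial_s\tau=\kappa\nu$; $\mathcal E(\gamma)=\int\kappa^2ds$, $\mathcal L(\gamma)=\int ds$, $\mathcal A(\gamma)=-\frac12\int\nu\cdot\gamma\,ds$ (algebraic area), $n_\gamma=\frac1{2\pi}\int\kappa\,ds$ (winding number). *)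

(* Defs.v *)
From mathcomp Require Export all_boot all_order all_algebra.
From mathcomp Require Export all_classical all_reals all_analysis.
Import Order.TTheory GRing.Theory Num.Theory numFieldNormedType.Exports.

Set Implicit Arguments.
Unset Strict Implicit.
Unset Printing Implicit Defensive.

Local Open Scope classical_set_scope.
Local Open Scope ring_scope.

(* A function on the circle R / (2 pi Z) is a 2pi-periodic function on R. Data
   that only matter almost everywhere (weak derivatives, curvature) are used
   only through their values on the fundamental domain [0, 2pi]. *)

Section circle.
Variable R : realType.
Local Notation mu := (@lebesgue_measure R).

Definition circle_dom : set R := `[0, 2 * pi].

Definition circle_integral (f : R -> R) : R :=
  \int[mu]_(x in circle_dom) f x.

Definition circle_L1 (f : R -> R) : Prop :=
  mu.-integrable circle_dom (EFin \o f).

Definition circle_L2 (f : R -> R) : Prop :=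
  measurable_fun circle_dom f /\
  mu.-integrable circle_dom (EFin \o (fun x => f x ^+ 2)).

Definition circle_test (phi : R -> R) : Prop :=
  periodic phi (2 * pi) /\ forall (n : nat) (x : R), derivable (derive1n n phi) x 1.

Definition weak_derivative (k : nat) (f g : R -> R) : Prop :=
  [/\ circle_L1 f, circle_L1 g &
    forall phi, circle_test phi ->
      circle_integral (fun x => f x * derive1n k phi x) =
      (-1) ^+ k * circle_integral (fun x => g x * phi x)].

(* The Sobolev space W^{k,2} of the circle. *)
Definition sobolev_k2 (k : nat) (f : R -> R) : Prop :=
  [/\ periodic f (2 * pi), circle_L2 f &
    forall j, (j <= k)%N -> exists2 g, circle_L2 g & weak_derivative j f g].

Definition C1 (f : R -> R) : Prop :=
  (forall x, derivable f x 1) /\ continuous (derive1 f).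

End circle.

Section curves.
Variable R : realType.
Implicit Types (gamma : R -> R * R) (f : R -> R).

Definition dot (u v : R * R) : R := u.1 * v.1 + u.2 * v.2.

Definition velocity gamma (x : R) : R * R :=
  (derive1 (fst \o gamma) x, derive1 (snd \o gamma) x).

Definition speed gamma (x : R) : R :=
  Num.sqrt (dot (velocity gamma x) (velocity gamma x)).

(* An element of W^{2,2} is a class of functions modulo a.e. equality. The
   pointwise condition on the derivative refers to its unique C^1
   representative, so gamma is required to be that representative. *)
Definition W22Imm gamma : Prop :=
  [/\ sobolev_k2 2 (fst \o gamma), sobolev_k2 2 (snd \o gamma),
      C1 (fst \o gamma), C1 (snd \o gamma) &
      forall x, velocity gamma x <> (0, 0)].

Definition integral_ds gamma f : R :=
  circle_integral (fun x => f x * speed gamma x).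

Definition tau gamma (x : R) : R * R :=
  ((velocity gamma x).1 / speed gamma x, (velocity gamma x).2 / speed gamma x).

Definition nu gamma (x : R) : R * R :=
  (- (tau gamma x).2, (tau gamma x).1).

(* d tau / ds = kappa nu, i.e. d tau / dx = |gamma'| kappa nu, where the
   derivative of the W^{1,2} function tau is a weak one. *)
Definition is_curvature gamma (kappa : R -> R) : Prop :=
  weak_derivative 1 (fun x => (tau gamma x).1)
    (fun x => speed gamma x * (kappa x * (nu gamma x).1)) /\
  weak_derivative 1 (fun x => (tau gamma x).2)
    (fun x => speed gamma x * (kappa x * (nu gamma x).2)).

(* For gamma in W22Imm such a kappa exists and is unique up to a.e. equality
   on [0, 2pi], so the integrals below do not depend on the choice. *)
Definition curvature gamma : R -> R := xget (fun=> 0) (is_curvature gamma).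

Definition bending_energy gamma : R :=
  integral_ds gamma (fun x => curvature gamma x ^+ 2).

Definition curve_length gamma : R := integral_ds gamma (fun=> 1).

Definition algebraic_area gamma : R :=
  - (1 / 2) * integral_ds gamma (fun x => dot (nu gamma x) (gamma x)).

Definition winding_number gamma : R :=
  (2 * pi)^-1 * integral_ds gamma (curvature gamma).

End curves.

(* The infimum is taken in the extended reals, so that it would be +oo, and not
   a default real value, if there were no admissible curve. *)
Definition energy_profile (R : realType) (l : R) : \bar R :=
  ereal_inf [set (bending_energy gamma)%:E | gamma in
    [set gamma : R -> R * R | [/\ W22Imm gamma, winding_number gamma = 1,
       algebraic_area gamma = pi & curve_length gamma = l]]].

(* Main.v *)
Require Import Defs.
From mathcomp Require Import measurable_realfun ring lra.
Import Order.TTheory GRing.Theory Num.Theory numFieldNormedType.Exports.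

Set Implicit Arguments.
Unset Strict Implicit.
Unset Printing Implicit Defensive.

Local Open Scope classical_set_scope.
Local Open Scope ring_scope.

(* Write T = 2 pi, and let L and A be the length and area of an immersed curve
   gamma with winding number 1, tangent tau and curvature kappa. By scaling, the
   energy of a curve with pi L^2 = l^2 A bounds E(l), since energy times length
   is scale invariant; and E(l) >= T^2 / l because kappa has integral T.

   Let w be a unit circle traversed once at constant speed with respect to the
   arc length s of gamma, forwards (eps = 1) or backwards (eps = -1), and let
   gamma_t = gamma + t w. With B the integral of det (w, gamma'),
     A(gamma_t) = A + t B + eps pi t^2,
     L(gamma_t) >= L + (t T / L) eps B,
     L(gamma_t)^2 <= L^2 + 2 T t eps B + T^2 t^2,
   and eps B >= 0 for w or for -w. Hence going backwards increases L^2 / A, and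
   going forwards does not increase L^2 - 4 pi A while increasing A, so decreases
   L^2 / A unless it is 4 pi; both at a rate that depends only on t, L and A.
   Since w is driven by the arc length of gamma, the energy of gamma_t is
   controlled by that of gamma and t alone, without any bound on the tangential
   part of gamma''. An intermediate value argument in t then moves a curve from
   the length l to any nearby length l', at an energy cost uniform over the
   curves of bounded energy, which gives continuity. Starting from the circle and
   going backwards reaches every l >= T. Starting from the Lissajous curve
   (cos x, sin 3x), which has winding number 1 and area 0, and going forwards
   reaches every large l with energy times length bounded, so E(l) -> 0.

   Weak derivatives are handled as integrands of indefinite Lebesgue integrals.
   A continuous function with weak derivative g is a primitive of g, by testing
   against powers of 1 + cos (x - a) - cos r. *)

(** * Integrals on segments and primitives *)

Section segment_integral.
Context {R : realType}.
Local Notation mu := (@lebesgue_measure R).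
Implicit Types (a b c x y : R) (f g h F G : R -> R).

Definition segint a b f : R := \int[mu]_(x in `[a, b]) f x.

Definition L1on a b f : Prop := mu.-integrable `[a, b] (EFin \o f).

Lemma eq_segint a b f g :
  (forall x, a <= x <= b -> f x = g x) -> segint a b f = segint a b g.
Proof.
by move=> fg; apply: eq_Rintegral => x; rewrite inE/= in_itv/=; exact: fg.
Qed.

Lemma eq_L1on a b f g :
  (forall x, a <= x <= b -> f x = g x) -> L1on a b f -> L1on a b g.
Proof.
move=> fg; apply: eq_integrable => //= x; rewrite inE/= in_itv/= => xab.
by rewrite fg.
Qed.

Lemma L1onS a b x y f : a <= x -> y <= b -> L1on a b f -> L1on x y f.
Proof.
move=> ax yb; apply: integrableS => //.
by move=> z /=; rewrite !in_itv/= => /andP[xz zy]; rewrite (le_trans ax) ?(le_trans zy).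
Qed.

Lemma L1onD a b f g :
  L1on a b f -> L1on a b g -> L1on a b (fun x => f x + g x).
Proof.
move=> If Ig.
suff: mu.-integrable `[a, b] ((EFin \o f) \+ (EFin \o g))%E.
  by apply: eq_integrable.
exact: integrableD.
Qed.

Lemma L1onZ a b k f : L1on a b f -> L1on a b (fun x => k * f x).
Proof.
move=> If.
suff: mu.-integrable `[a, b] (fun x => k%:E * (EFin \o f) x)%E.
  by apply: eq_integrable.
exact: integrableZl.
Qed.

Lemma L1onN a b f : L1on a b f -> L1on a b (fun x => - f x).
Proof. by move=> /(L1onZ (-1)); apply: eq_L1on => x _; rewrite mulN1r. Qed.

Lemma L1onB a b f g :
  L1on a b f -> L1on a b g -> L1on a b (fun x => f x - g x).
Proof. by move=> If Ig; exact: L1onD (L1onN Ig). Qed.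

Lemma L1on_norm a b f : L1on a b f -> L1on a b (fun x => `|f x|).
Proof. exact: integrable_norm. Qed.

Lemma L1on_measurable a b f : L1on a b f -> measurable_fun `[a, b] f.
Proof. by move=> /measurable_int/measurable_EFinP. Qed.

Lemma L1on_cont a b f : {within `[a, b], continuous f} -> L1on a b f.
Proof.
by move=> cf; apply: continuous_compact_integrable => //; exact: segment_compact.
Qed.

Lemma within_cont_measurable a b f :
  {within `[a, b], continuous f} -> measurable_fun `[a, b] f.
Proof. by move=> /L1on_cont/L1on_measurable. Qed.

Lemma within_cont_bounded a b f : {within `[a, b], continuous f} ->
  exists2 M, 0 < M & forall x, a <= x <= b -> `|f x| <= M.
Proof.
move=> cf; have /compact_bounded[M [_ Mf]] :=
  continuous_compact cf (@segment_compact _ a b).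
exists (`|M| + 1); first by rewrite ltr_pwDr.
move=> x xab; apply: Mf; first by rewrite ltr_pwDr// ler_norm.
by exists x => //=; rewrite in_itv.
Qed.

Lemma L1onM a b f g : {within `[a, b], continuous f} -> L1on a b g ->
  L1on a b (fun x => f x * g x).
Proof.
move=> cf Ig; have [M M0 fM] := within_cont_bounded cf.
suff: mu.-integrable `[a, b] ((EFin \o f) \* (EFin \o g))%E.
  by apply: eq_integrable.
apply: integrableMr => //; first exact: within_cont_measurable.
exists M; split; first exact: gtr0_real.
by move=> N MN x/=; rewrite in_itv/= => /fM /le_trans; apply; exact: ltW.
Qed.

Lemma segintZ a b k f : L1on a b f ->
  segint a b (fun x => k * f x) = k * segint a b f.
Proof. by move=> If; rewrite /segint RintegralZl. Qed.

Lemma segintD a b f g : L1on a b f -> L1on a b g ->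
  segint a b (fun x => f x + g x) = segint a b f + segint a b g.
Proof. by move=> If Ig; rewrite /segint RintegralD. Qed.

Lemma segintB a b f g : L1on a b f -> L1on a b g ->
  segint a b (fun x => f x - g x) = segint a b f - segint a b g.
Proof. by move=> If Ig; rewrite /segint RintegralB. Qed.

Lemma segintN a b f : L1on a b f ->
  segint a b (fun x => - f x) = - segint a b f.
Proof.
move=> If; rewrite -mulN1r -segintZ//.
by apply: eq_segint => x _; rewrite mulN1r.
Qed.

Lemma segint_cst a b k : a <= b -> segint a b (fun=> k) = k * (b - a).
Proof.
move=> ab; rewrite /segint Rintegral_cst//= lebesgue_measure_itv/= lte_fin.
case: ltP => [//|ba]; suff -> : a = b by rewrite subrr.
by apply/le_anti; rewrite ab ba.
Qed.

Lemma le_segint a b f g : L1on a b f -> L1on a b g ->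
  (forall x, a <= x <= b -> f x <= g x) -> segint a b f <= segint a b g.
Proof.
move=> If Ig fg; apply: le_Rintegral => // x /=; rewrite in_itv/=; exact: fg.
Qed.

Lemma segint_ge0 a b f :
  (forall x, a <= x <= b -> 0 <= f x) -> 0 <= segint a b f.
Proof. by move=> f0; apply: Rintegral_ge0 => x/=; rewrite in_itv/=; exact: f0. Qed.

Lemma norm_segint a b f : L1on a b f ->
  `|segint a b f| <= segint a b (fun x => `|f x|).
Proof. by move=> If; exact: le_normr_Rintegral. Qed.

Lemma segintxx a f : segint a a f = 0.
Proof. by rewrite /segint set_itv1 Rintegral_set1. Qed.

Lemma segint_chasles a b c f : a <= b -> b <= c -> L1on a c f ->
  segint a c f = segint a b f + segint b c f.
Proof.
move=> ab bc If.
have := @Rintegral_itvB _ f (BLeft a) (BRight c) b If.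
rewrite !bnd_simp => /(_ ab bc) E.
rewrite /segint -(@Rintegral_itv_obnd_cbnd _ b (BRight c)) -?E; first by ring.
by apply: integrableS If => // z/=; rewrite !in_itv/= => /andP[bz ->]; lra.
Qed.

(** Heine-Cantor: around each point half of the radius of continuity serves all nearby pairs, and
    compactness, in its near-covering form, turns these local radii into one. *)
Lemma within_unif_continuous a b f : {within `[a, b], continuous f} ->
  forall e : R, 0 < e -> exists2 d : R, 0 < d & forall x y,
    a <= x <= b -> a <= y <= b -> `|x - y| < d -> `|f x - f y| < e.
Proof.
move=> cf e e0.
have /compact_near_coveringP cpt := @segment_compact _ a b.
have /cpt : forall x, `[a, b]%classic x -> \forall x' \near x & d \near 0^'+,
    `[a, b]%classic x' -> forall y, a <= y <= b -> `|x' - y| < d -> `|f x' - f y| < e.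
  have e20 : 0 < e / 2 by lra.
  move=> x xab; have /subspace_continuousP/(_ x xab)/cvgrPdist_lt := cf.
  move=> /(_ _ e20); rewrite near_withinE => -[d/= d0 fd].
  exists (ball x (d / 2), [set t | t < d / 2]) => /=.
    split; first by apply: nbhsx_ballx; rewrite divr_gt0.
    by apply: nbhs_right_lt; rewrite divr_gt0.
  move=> [x' t]/= [xx' td] x'ab y yab x'y.
  have fx' : `|f x - f x'| < e / 2.
    by apply: fd => //=; apply: lt_le_trans xx' _; lra.
  have fy : `|f x - f y| < e / 2.
    apply: fd => //=.
    rewrite (_ : x - y = (x - x') + (x' - y)); last by ring.
    by rewrite (le_lt_trans (ler_normD _ _))//; move: xx'; rewrite /ball/=; lra.
  rewrite (_ : f x' - f y = (f x - f y) - (f x - f x')); last by ring.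
  by rewrite (le_lt_trans (ler_normB _ _))//; lra.
move=> [d/= d0 fd]; exists (d / 2); first by rewrite divr_gt0.
move=> x y xab yab xy; apply: (fd (d / 2)) => //=; rewrite ?divr_gt0 ?in_itv//.
by rewrite sub0r normrN gtr0_norm ?divr_gt0//; lra.
Qed.
End segment_integral.

(** * Absolutely continuous functions: product rule, chain rule, uniqueness of the derivative *)

Section primitives.
Context {R : realType}.
Local Notation mu := (@lebesgue_measure R).
Implicit Types (a b c x y : R) (f g h m F G : R -> R).

(** Absolute continuity of [F] with almost everywhere derivative [f], in integrated form, so that
    the product and chain rules need no differentiation almost everywhere. *)
Definition primitive_on a b F f : Prop := L1on a b f /\
  forall x y, a <= x -> x <= y -> y <= b -> F y - F x = segint x y f.

Lemma primitive_L1 a b F f : primitive_on a b F f -> L1on a b f.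
Proof. by case. Qed.

Lemma eq_primitive a b F G f g :
  (forall x, a <= x <= b -> F x = G x) -> (forall x, a <= x <= b -> f x = g x) ->
  primitive_on a b F f -> primitive_on a b G g.
Proof.
move=> FG fg [If Ff]; split; first exact: eq_L1on If.
move=> x y ax xy yb; rewrite -!FG ?ax ?yb ?(le_trans ax)// ?(le_trans xy)//.
rewrite Ff//; apply: eq_segint => z /andP[xz zy].
by rewrite fg// (le_trans ax)//= (le_trans zy).
Qed.

Lemma primitive_cst a b c : primitive_on a b (fun=> c) (fun=> 0).
Proof.
split; first by apply: L1on_cont; apply: continuous_subspaceT => x; exact: cvg_cst.
by move=> x y ax xy yb; rewrite segint_cst// subrr mul0r.
Qed.

Lemma primitiveD a b F G f g : primitive_on a b F f -> primitive_on a b G g ->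
  primitive_on a b (fun x => F x + G x) (fun x => f x + g x).
Proof.
move=> [If Ff] [Ig Gg]; split; first exact: L1onD.
move=> x y ax xy yb; rewrite segintD -?Ff -?Gg//; first by ring.
  exact: L1onS If.
exact: L1onS Ig.
Qed.

Lemma primitiveZ a b k F f : primitive_on a b F f ->
  primitive_on a b (fun x => k * F x) (fun x => k * f x).
Proof.
move=> [If Ff]; split; first exact: L1onZ.
by move=> x y ax xy yb; rewrite segintZ -?Ff -?mulrBr//; exact: L1onS If.
Qed.

Lemma primitiveN a b F f : primitive_on a b F f ->
  primitive_on a b (fun x => - F x) (fun x => - f x).
Proof.
by move=> /(primitiveZ (-1)); apply: eq_primitive => x _; rewrite mulN1r.
Qed.

Lemma primitive_within_continuous a b F f : a <= b -> primitive_on a b F f ->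
  {within `[a, b], continuous F}.
Proof.
move=> ab [If Ff].
have cI := parameterized_integral_continuous ab If.
apply: (@subspace_eq_continuous _ _ _ (fun x => F a + segint a x f)).
  move=> x; rewrite inE/= in_itv/= => /andP[ax xb].
  by rewrite -Ff// addrC subrK.
by move=> x; apply: cvgD; [exact: cvg_cst|exact: cI].
Qed.

Lemma norm_segint_le a b e f m : L1on a b f -> L1on a b m ->
  (forall x, a <= x <= b -> `|f x| <= e * m x) ->
  `|segint a b f| <= e * segint a b m.
Proof.
move=> If Im fm; apply: le_trans (norm_segint If) _; rewrite -segintZ//.
by apply: le_segint fm; [exact: L1on_norm|exact: L1onZ].
Qed.

(* Both sides of the estimate are additive over a partition, so that the
   estimate on short segments propagates to all of [a, b]. *)
Lemma primitive_partition a b F f m : L1on a b f -> L1on a b m ->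
  (forall e : R, 0 < e -> exists2 d : R, 0 < d & forall x y,
    a <= x -> x <= y -> y <= b -> y - x < d ->
    `|F y - F x - segint x y f| <= e * segint x y m) ->
  primitive_on a b F f.
Proof.
move=> If Im H; split => // x y ax xy yb.
have {}H (e : R) : 0 < e -> `|F y - F x - segint x y f| <= e * segint x y m.
  move=> /H [d d0 {}H].
  have [N Nd] : exists N : nat, (y - x) / N.+1%:R < d.
    exists (Num.truncn ((y - x) / d)); rewrite ltr_pdivrMr// mulrC -ltr_pdivrMr//.
    by rewrite truncnS_gt.
  pose t k := x + k%:R * ((y - x) / N.+1%:R).
  have step0 : 0 <= (y - x) / N.+1%:R by rewrite divr_ge0// subr_ge0.
  have tS k : t k.+1 - t k = (y - x) / N.+1%:R.
    by rewrite /t -natr1; ring.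
  have tN : t N.+1 = y by rewrite /t mulrC divfK ?pnatr_eq0//; ring.
  have tle j k : (j <= k)%N -> t j <= t k.
    by move=> jk; rewrite /t lerD2l ler_wpM2r// ler_nat.
  have t0 : t 0%N = x by rewrite /t mul0r addr0.
  suff /(_ N.+1 (leqnn _)) : forall k, (k <= N.+1)%N ->
      `|F (t k) - F x - segint x (t k) f| <= e * segint x (t k) m by rewrite tN.
  elim=> [_|k IH kN]; first by rewrite t0 !segintxx !subrr normr0 mulr0.
  have xt : x <= t k by rewrite -t0 tle.
  have tt : t k <= t k.+1 by rewrite tle.
  have ty : t k.+1 <= y by rewrite -tN tle.
  have ty' := le_trans ty yb.
  have Ifx : L1on x (t k.+1) f by exact: L1onS If.
  have Imx : L1on x (t k.+1) m by exact: L1onS Im.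
  rewrite (segint_chasles xt tt Ifx) (segint_chasles xt tt Imx) mulrDr.
  rewrite [leLHS](_ : _ = `|(F (t k) - F x - segint x (t k) f) +
     (F (t k.+1) - F (t k) - segint (t k) (t k.+1) f)|); last by congr `| _ |; ring.
  apply: le_trans (ler_normD _ _) _; apply: lerD; first exact/IH/ltnW.
  by apply: H => //; [exact: le_trans xt|rewrite tS].
apply/eqP; rewrite -subr_eq0 -normr_le0; apply/ler_addgt0Pl => e e0.
rewrite addr0.
pose S := segint x y m.
have S1 : 0 < `|S| + 1 by rewrite ltr_pwDr.
apply: le_trans (H (e / (`|S| + 1)) _) _; first by rewrite divr_gt0.
rewrite mulrAC ler_pdivrMr// ler_wpM2l ?(ltW e0)//.
by apply: le_trans (ler_norm _) _; rewrite lerDl.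
Qed.

(** On a short segment from [x] to [y] the error is the integral of
    [(G y - G t) * f t + (F x - F t) * g t], which uniform continuity of [F] and [G] makes small
    relative to the integral of [|f| + |g|]. *)
Lemma primitiveM a b F G f g : a <= b ->
  primitive_on a b F f -> primitive_on a b G g ->
  primitive_on a b (fun x => F x * G x) (fun x => f x * G x + F x * g x).
Proof.
move=> ab Ff Gg.
have cF := primitive_within_continuous ab Ff.
have cG := primitive_within_continuous ab Gg.
have [[If FE] [Ig GE]] := (Ff, Gg).
have IfG : L1on a b (fun x => f x * G x).
  by apply: eq_L1on (L1onM cG If) => x _; rewrite mulrC.
have IFg := L1onM cF Ig.
apply: (@primitive_partition _ _ _ _ (fun x => `|f x| + `|g x|)).
- exact: L1onD.
- by apply: L1onD; exact: L1on_norm.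
move=> e e0; have [d1 d10 F1] := within_unif_continuous cF e0.
have [d2 d20 G2] := within_unif_continuous cG e0.
exists (Num.min d1 d2); first by rewrite lt_min d10.
move=> x y ax xy yb; rewrite lt_min => /andP[xy1 xy2].
have S h : L1on a b h -> L1on x y h by exact: L1onS.
rewrite [X in `|X|](_ : _ = segint x y (fun t =>
    G y * f t + F x * g t - (f t * G t + F t * g t))); last first.
  rewrite segintB ?segintD ?segintZ; try exact: S.
  - by rewrite -FE// -GE//; ring.
  - by apply: L1onZ; exact: S.
  - by apply: L1onZ; exact: S.
  - by apply: L1onD; apply: L1onZ; exact: S.
  - by apply: L1onD; exact: S.
apply: norm_segint_le.
- by apply: L1onB; apply: L1onD; do ?[apply: L1onZ]; exact: S.
- by apply: L1onD; apply: L1on_norm; exact: S.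
move=> t /andP[xt ty].
rewrite [X in `|X|](_ : _ = (G y - G t) * f t + (F x - F t) * g t); last by ring.
rewrite mulrDr (le_trans (ler_normD _ _))// !normrM lerD// ler_wpM2r//.
  apply/ltW/G2; rewrite ?(le_trans ax)//= ?yb//; first exact: le_trans yb.
  by rewrite ger0_norm ?subr_ge0//; lra.
apply/ltW/F1; rewrite ?ax ?(le_trans ax)//=; try lra.
by rewrite distrC ger0_norm ?subr_ge0//; lra.
Qed.

(** Serves the chain rule, where the end values [F x] and [F y] may come in either order. *)
Lemma MVT_unordered f df x y :
  (forall z, Num.min x y <= z <= Num.max x y -> is_derive z 1 f (df z)) ->
  exists2 c, Num.min x y <= c <= Num.max x y & f y - f x = df c * (y - x).
Proof.
wlog xy : x y / x <= y.
  move=> H; have /orP[/H//|yx] := le_total x y.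
  rewrite minC maxC => fdf; have [c cxy E] := H y x yx fdf.
  by exists c => //; rewrite -opprB E; ring.
rewrite (min_idPl xy) (max_idPr xy) => fdf.
have [||c cxy E] := @MVT_segment _ f df x y xy.
- by move=> z; rewrite in_itv/= => /andP[/ltW xz /ltW zy]; apply: fdf; rewrite xz.
- apply: derivable_within_continuous => z; rewrite in_itv/= => zxy.
  by have [] := fdf z zxy.
by exists c => //; move: cxy; rewrite in_itv.
Qed.

(** By the mean value theorem, and the intermediate value theorem for [F], the increment of [Phi]
    between [F x] and [F y] is [phi (F s) * (F y - F x)] for some [s] between [x] and [y]. The error
    is thus the integral of [(phi (F s) - phi (F t)) * f t]. *)
Lemma primitive_comp a b F f (Phi phi : R -> R) : a <= b ->
  primitive_on a b F f ->
  (forall x, a <= x <= b -> is_derive (F x) 1 Phi (phi (F x))) ->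
  {within `[a, b], continuous (phi \o F)} ->
  primitive_on a b (Phi \o F) (fun x => phi (F x) * f x).
Proof.
move=> ab Ff dPhi cphi.
have cF := primitive_within_continuous ab Ff.
have [If FE] := Ff.
have Ipf : L1on a b (fun x => phi (F x) * f x) by exact: (L1onM cphi If).
apply: (@primitive_partition _ _ _ _ (fun x => `|f x|)) => //.
  exact: L1on_norm.
move=> e e0; have [d d0 H] := within_unif_continuous cphi e0.
exists d => // x y ax xy yb xyd.
have onF z : Num.min (F x) (F y) <= z <= Num.max (F x) (F y) ->
    exists2 t, x <= t <= y & F t = z.
  move=> zF; have [|t] := IVT xy _ zF.
    by apply: continuous_subspaceW cF => t/=; rewrite !in_itv/= => /andP[? ?]; lra.
  by rewrite in_itv/=; exists t.
have [|c /onF[s /andP[xs sy] <-] E] := @MVT_unordered Phi phi (F x) (F y).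
  by move=> z /onF[t /andP[xt ty] <-]; apply: dPhi; lra.
have S h : L1on a b h -> L1on x y h by exact: L1onS.
rewrite [X in `|X|](_ : _ = segint x y (fun t =>
    phi (F s) * f t - phi (F t) * f t)); last first.
  rewrite segintB ?segintZ/= ?E -?FE//; try exact: S.
  by apply: L1onZ; exact: S.
apply: norm_segint_le.
- by apply: L1onB; [apply: L1onZ|]; exact: S.
- by apply: L1on_norm; exact: S.
move=> t /andP[xt ty]; rewrite -mulrBl normrM ler_wpM2r//.
apply/ltW/H => /=; rewrite ?lerBlDr; try lra.
by rewrite ltr_norml; apply/andP; split; lra.
Qed.

Lemma primitive_is_derive a b F f : a <= b ->
  (forall x, is_derive x 1 F (f x)) -> continuous f -> primitive_on a b F f.
Proof.
move=> ab dF cf; split; first exact/L1on_cont/continuous_subspaceT.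
move=> x y ax xy yb; move: xy; rewrite le_eqVlt => /predU1P[->|xy].
  by rewrite segintxx subrr.
have cF : continuous F.
  move=> z; apply: differentiable_continuous; apply/derivable1_diffP.
  by have [] := dF z.
rewrite /segint /Rintegral (@continuous_FTC2 _ f F)//.
- exact: continuous_subspaceT.
- split; [by move=> z _; have [] := dF z| |].
    exact/cvg_at_right_filter/cF.
  exact/cvg_at_left_filter/cF.
- by move=> z _; rewrite derive1E; have [_ ->] := dF z.
Qed.

(** The difference [f - g], extended by zero, has integral zero over every half-line, so it vanishes
    almost everywhere by Lebesgue differentiation. *)
Lemma primitive_ae_unique a b F f g :
  primitive_on a b F f -> primitive_on a b F g ->
  {ae mu, forall x, a <= x <= b -> f x = g x}.
Proof.
move=> [If Ff] [Ig Fg].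
pose h := (fun x => f x - g x) \_ `[a, b].
have Ih : mu.-integrable setT (EFin \o h).
  rewrite -restrict_EFin; apply/integrable_restrict => //=.
  by rewrite setTI; exact: L1onB.
have h0 y : \int[mu]_(t in [set` `]-oo, y]]) h t = 0.
  rewrite -Rintegral_mkcondr.
  rewrite (_ : _ `&` _ = `[a, Num.min y b]%classic); last first.
    apply/seteqP; split => z /=; rewrite !in_itv/= le_min.
      by move=> [-> /andP[-> ->]].
    by move=> /and3P[-> -> ->].
  have [ba|ab] := ltP (Num.min y b) a.
    by rewrite set_itv_ge ?bnd_simp -?ltNge// Rintegral_set0.
  have mb : Num.min y b <= b by rewrite ge_min lexx orbT.
  rewrite -/(segint _ _ _) segintB -?Ff -?Fg ?subrr//.
  - exact: L1onS If.
  - exact: L1onS Ig.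
have Ihy y : mu.-integrable `]-oo, y] (EFin \o h) by exact: integrableS Ih.
have lh : locally_integrable [set: R] h.
  by apply: integrable_locally => //; exact: L1onB.
have := FTC1Ny Ihy lh; rewrite (_ : (fun y => _) = cst 0); last first.
  by apply/funext => y; exact: h0.
apply: filterS; first exact: (ae_filter_ringOfSetsType mu).
move=> x [_]; rewrite derive1_cst => + /andP[ax xb].
rewrite /h patchE mem_set ?in_itv/= ?in_itv/= ?ax//.
by move/esym/eqP; rewrite subr_eq0 => /eqP.
Qed.

Section antiderivative.
Variable f : R -> R.
Hypothesis cf : continuous f.

(** The integral from 0 to [x] with its sign; the case split is there because [segint] is 0, not
    negated, when its bounds are reversed. *)
Definition antiderivative x : R :=
  if 0 <= x then segint 0 x f else - segint x 0 f.

Let If a b : L1on a b f.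
Proof. exact/L1on_cont/continuous_subspaceT. Qed.

Lemma antiderivativeB x y :
  x <= y -> antiderivative y - antiderivative x = segint x y f.
Proof.
move=> xy; rewrite /antiderivative.
have [x0|x0] := leP 0 x.
  rewrite (le_trans x0 xy) (segint_chasles x0 xy (If 0 y)); ring.
have [y0|y0] := leP 0 y.
  by rewrite (segint_chasles (ltW x0) y0 (If x y)); ring.
rewrite (segint_chasles xy (ltW y0) (If x 0)); ring.
Qed.

Lemma is_derive_antiderivative x : is_derive x 1 antiderivative (f x).
Proof.
have xx : x - 1 < x by rewrite gtrBl.
have xx1 : x < x + 1 by rewrite ltrDl.
have [dF dFE] := continuous_FTC1_closed xx1 (If (x - 1) (x + 1)) xx (@cf x).
(* With base point [x - 1] the point [x] is interior to the segment of integration; near [x] the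
   function [G] agrees with the antiderivative. *)
pose G := (fun y => segint (x - 1) y f) + cst (antiderivative (x - 1)).
have dG : is_derive x 1 G (f x).
  rewrite -[f x]addr0; apply: is_deriveD.
  by apply: DeriveDef; [exact: dF|rewrite -derive1E; exact: dFE].
apply: near_eq_is_derive dG.
near=> y; rewrite /G /= fctE -antiderivativeB ?subrK//.
by apply/ltW; near: y; apply: lt_nbhsr; lra.
Unshelve. all: by end_near. Qed.

End antiderivative.

End primitives.

(** * Square-integrable functions on a segment *)

Section square_integrable.
Context {R : realType}.
Local Notation mu := (@lebesgue_measure R).
Implicit Types (a b c x y : R) (f g h : R -> R).

Definition L2on a b f : Prop :=
  measurable_fun `[a, b] f /\ L1on a b (fun x => f x ^+ 2).

Lemma L1on_dominated a b f g : measurable_fun `[a, b] f -> L1on a b g ->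
  (forall x, a <= x <= b -> `|f x| <= g x) -> L1on a b f.
Proof.
move=> mf Ig fg; apply: le_integrable Ig => //; first exact/measurable_EFinP.
move=> x /=; rewrite in_itv/= lee_fin => /fg /le_trans; apply.
exact: ler_norm.
Qed.

Lemma L2on_L1 a b f : L2on a b f -> L1on a b f.
Proof.
move=> [mf If2]; apply: (@L1on_dominated _ _ _ (fun x => 1 + f x ^+ 2)) => //.
  by apply: L1onD => //; apply/L1on_cont/continuous_subspaceT => x; exact: cvg_cst.
by move=> x _; rewrite -[f x ^+ 2]real_normK ?num_real//; nra.
Qed.

Lemma eq_L2on a b f g :
  (forall x, a <= x <= b -> f x = g x) -> L2on a b f -> L2on a b g.
Proof.
move=> fg [mf If2]; split; last by apply: eq_L1on If2 => x /fg ->.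
by apply: eq_measurable_fun mf => x; rewrite inE/= in_itv/= => /fg.
Qed.

Lemma L2onD a b f g : L2on a b f -> L2on a b g ->
  L2on a b (fun x => f x + g x).
Proof.
move=> [mf If2] [mg Ig2].
have mfg : measurable_fun `[a, b] (fun x => f x + g x) by exact: measurable_funD.
split => //.
apply: (@L1on_dominated _ _ _ (fun x => 2 * f x ^+ 2 + 2 * g x ^+ 2)).
- exact: measurable_funX.
- by apply: L1onD; exact: L1onZ.
- by move=> x _; rewrite ger0_norm ?sqr_ge0//; have := sqr_ge0 (f x - g x); nra.
Qed.

Lemma L2onM a b f g : {within `[a, b], continuous f} -> L2on a b g ->
  L2on a b (fun x => f x * g x).
Proof.
move=> cf [mg Ig2]; split.
  by apply: measurable_funM => //; exact: within_cont_measurable.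
have cf2 : {within `[a, b], continuous (fun x => f x * f x)}.
  by move=> x; apply: cvgM; exact: cf.
apply: eq_L1on (L1onM cf2 Ig2) => x _; by rewrite exprMn.
Qed.

Lemma L2on_cont a b f : {within `[a, b], continuous f} -> L2on a b f.
Proof.
move=> cf; split; first exact: within_cont_measurable.
apply: L1on_cont.
by move=> x; apply: cvgM; exact: cf.
Qed.

Lemma L2onN a b f : L2on a b f -> L2on a b (fun x => - f x).
Proof.
move=> If; apply: (@eq_L2on _ _ (fun x => -1 * f x)); first by move=> x _; rewrite mulN1r.
by apply: L2onM => //; apply: continuous_subspaceT => x; exact: cvg_cst.
Qed.

End square_integrable.

(** * Calculus of pointwise derivatives, and periodicity *)

Section derivatives.
Context {R : realType}.
Implicit Types (f g : R -> R) (x a b : R).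

Lemma is_derive_eq1 f x a b : is_derive x 1 f a -> a = b -> is_derive x 1 f b.
Proof. by move=> ? <-. Qed.

Lemma is_derive1D f g x a b : is_derive x 1 f a -> is_derive x 1 g b ->
  is_derive x 1 (fun y => f y + g y) (a + b).
Proof. by move=> df dg; exact: is_deriveD. Qed.

Lemma is_derive1N f x a : is_derive x 1 f a ->
  is_derive x 1 (fun y => - f y) (- a).
Proof. by move=> df; exact: is_deriveN. Qed.

Lemma is_derive1B f g x a b : is_derive x 1 f a -> is_derive x 1 g b ->
  is_derive x 1 (fun y => f y - g y) (a - b).
Proof. by move=> df dg; exact: is_deriveB. Qed.

Lemma is_derive1M f g x a b : is_derive x 1 f a -> is_derive x 1 g b ->
  is_derive x 1 (fun y => f y * g y) (a * g x + f x * b).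
Proof.
move=> df dg; have dfg : is_derive x 1 (fun y => f y * g y) _ := is_deriveM df dg.
by apply: is_derive_eq1 dfg _; rewrite /GRing.scale/=; ring.
Qed.

Lemma is_derive1Z f x k a : is_derive x 1 f a ->
  is_derive x 1 (fun y => k * f y) (k * a).
Proof. by move=> df; have := @is_deriveZ _ _ _ f k x 1 a df. Qed.

Lemma is_derive1_comp f g x a b : is_derive x 1 f a -> is_derive (f x) 1 g b ->
  is_derive x 1 (fun y => g (f y)) (b * a).
Proof.
move=> [df fE] [dg gE]; apply: DeriveDef.
  apply/derivable1_diffP; apply: differentiable_comp; exact/derivable1_diffP.
by rewrite -derive1E (derive1_comp df dg) !derive1E fE gE.
Qed.

Lemma is_derive1_derivable f x a : is_derive x 1 f a -> derivable f x 1.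
Proof. by case. Qed.

Lemma is_derive1_derive1 f x a : is_derive x 1 f a -> derive1 f x = a.
Proof. by case=> _; rewrite derive1E. Qed.

Lemma derivable_is_derive1 f x : derivable f x 1 -> is_derive x 1 f (derive1 f x).
Proof. by move=> df; apply: DeriveDef => //; rewrite derive1E. Qed.

Lemma derivable1_continuous f : (forall x, derivable f x 1) -> continuous f.
Proof.
by move=> df x; apply: differentiable_continuous; exact/derivable1_diffP.
Qed.

Lemma derive1_periodic f T : (forall x, derivable f x 1) -> periodic f T ->
  periodic (derive1 f) T.
Proof.
move=> df fT x; apply/esym/is_derive1_derive1.
have E : f = (fun y => f (y + T)) by apply/funext => y; rewrite fT.
rewrite [X in is_derive _ _ X]E -[derive1 f (x + T)]mulr1.
apply: (@is_derive1_comp (fun y => y + T)); last exact: derivable_is_derive1.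
by rewrite -[X in is_derive _ _ _ X]addr0; apply: is_derive1D; exact: is_derive_cst.
Qed.

(** The increment over one period has derivative [f (x + T) - f x = 0], so it equals its value at
    0. *)
Lemma antiderivative_periodic f T : continuous f -> periodic f T -> 0 <= T ->
  forall x, antiderivative f (x + T) = antiderivative f x + segint 0 T f.
Proof.
move=> cf fT T0 x.
pose D y := antiderivative f (y + T) - antiderivative f y.
have dD (y : R) : is_derive y (1 : R) (D : R -> R) 0.
  rewrite -(subrr (f y)) -[X in X - _](fT y); apply: is_derive1B; last first.
    exact: is_derive_antiderivative.
  rewrite -[f (y + T)]mulr1.
  apply: (@is_derive1_comp (fun y => y + T)); last exact: is_derive_antiderivative.
  by rewrite -[X in is_derive _ _ _ X]addr0; apply: is_derive1D; exact: is_derive_cst.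
have := is_derive_0_is_cst x 0 dD.
by rewrite /D add0r -(antiderivativeB cf T0) => <-; ring.
Qed.

End derivatives.

(** * Trigonometric polynomials as test functions *)

Section smooth_functions.
Context {R : realType}.
Implicit Types (f g phi psi : R -> R) (x a b : R).

Definition smooth f := forall n x, derivable (derive1n n f) x 1.

Lemma smooth_derive1 f : smooth f -> smooth (derive1 f).
Proof. by move=> sf n x; have := sf n.+1 x; rewrite /derive1n iterSr. Qed.

Lemma smooth_derivable f : smooth f -> forall x, derivable f x 1.
Proof. by move=> /(_ 0%N). Qed.

Lemma smooth_continuous f : smooth f -> continuous f.
Proof. by move=> /smooth_derivable/derivable1_continuous. Qed.

Lemma smooth_of_derive1 f g :
  (forall x, is_derive x 1 f (g x)) -> smooth g -> smooth f.
Proof.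
move=> dfg sg [|n] x; first exact: is_derive1_derivable.
rewrite /derive1n iterSr (_ : derive1 f = g); first exact: sg.
by apply/funext => y; exact: is_derive1_derive1.
Qed.

(** An inductive closure, so that stability under differentiation, hence smoothness, and periodicity
    follow by induction. The shift [a] lets the peaks be centred anywhere. *)
Inductive trig_poly a : (R -> R) -> Prop :=
| trig_cst c : trig_poly a (fun=> c)
| trig_cos : trig_poly a (fun x => cos (x - a))
| trig_sin : trig_poly a (fun x => sin (x - a))
| trig_add f g : trig_poly a f -> trig_poly a g -> trig_poly a (fun x => f x + g x)
| trig_mul f g : trig_poly a f -> trig_poly a g -> trig_poly a (fun x => f x * g x).

Lemma trig_poly_derive a f : trig_poly a f ->
  exists2 g, trig_poly a g & forall x, is_derive x 1 f (g x).
Proof.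
have dB x : is_derive x 1 (fun y => y - a) 1.
  by rewrite -[X in is_derive _ _ _ X]subr0; apply: is_derive1B; exact: is_derive_cst.
elim => {f} [c| | |f g _ [f' tf df] _ [g' tg dg]|f g tf [f' tf' df] tg [g' tg' dg]].
- by exists (fun=> 0); [exact: trig_cst|move=> x; exact: is_derive_cst].
- exists (fun x => -1 * sin (x - a)).
    by apply: trig_mul; [exact: trig_cst|exact: trig_sin].
  move=> x; apply: (is_derive_eq1 (@is_derive1_comp _ _ cos _ _ _ (dB x) (is_derive_cos _))).
  by rewrite mulr1 mulN1r.
- exists (fun x => cos (x - a)); first exact: trig_cos.
  move=> x; apply: (is_derive_eq1 (@is_derive1_comp _ _ sin _ _ _ (dB x) (is_derive_sin _))).
  by rewrite mulr1.
- by exists (fun x => f' x + g' x); [exact: trig_add|move=> x; exact: is_derive1D].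
- exists (fun x => f' x * g x + f x * g' x); last by move=> x; exact: is_derive1M.
  by apply: trig_add; exact: trig_mul.
Qed.

Lemma trig_poly_smooth a f : trig_poly a f -> smooth f.
Proof.
move=> + n; elim: n f => [|n IH] f /trig_poly_derive[g tg dg] x.
  exact: is_derive1_derivable.
rewrite /derive1n iterSr (_ : derive1 f = g); first exact: IH.
by apply/funext => y; exact: is_derive1_derive1.
Qed.

Lemma trig_polyX a f n : trig_poly a f -> trig_poly a (fun x => f x ^+ n).
Proof.
move=> tf; elim: n => [|n IH]; first exact: trig_cst.
rewrite (_ : (fun x => _) = (fun x => f x * f x ^+ n)); first exact: trig_mul.
by apply/funext => x; rewrite exprS.
Qed.

Lemma trig_poly_periodic a f : trig_poly a f -> periodic f (2 * pi).
Proof.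
elim => {f} [c| | |f g _ fp _ gp|f g _ fp _ gp] x //.
- by rewrite addrAC mulr_natl cosD2pi.
- by rewrite addrAC mulr_natl sinD2pi.
- by rewrite fp gp.
- by rewrite fp gp.
Qed.

(** Bernoulli's inequality. *)
Lemma one_add_exp (d : R) n : 0 <= d -> 1 + n%:R * d <= (1 + d) ^+ n.
Proof.
move=> d0; elim: n => [|n IH]; first by rewrite mul0r addr0.
rewrite exprS -natr1; apply: le_trans (ler_wpM2l _ IH); last by rewrite addr_ge0.
have : 0 <= n%:R * d * d by rewrite !mulr_ge0.
by nra.
Qed.

(* The powers of 1 + cos (x - c) - cos r blow up near c, and stay bounded by 1
   on the rest of the period. *)
Lemma trig_poly_separates (h : R -> R) :
  {within `[0, 2 * pi], continuous h} ->
  (forall a psi, trig_poly a psi -> segint 0 (2 * pi) (fun x => h x * psi x) = 0) ->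
  forall x, 0 <= x <= 2 * pi -> h x = 0.
Proof.
wlog pos : h / exists2 x, 0 <= x <= 2 * pi & 0 < h x.
  move=> H ch hpsi x xI; have [//|] := eqVneq (h x) 0; rewrite neq_lt => hx.
  have [hx0|hx0] := orP hx; last first.
    by apply: (H h _ ch hpsi x xI); exists x.
  apply: oppr_inj; rewrite oppr0; apply: (H (fun y => - h y) _ _ _ x xI).
  - by exists x; rewrite ?oppr_gt0.
  - by move=> y; apply: cvgN; exact: ch.
  move=> a psi tpsi.
  rewrite (@eq_segint _ _ _ _ (fun x => -1 * (h x * psi x))); last first.
    by move=> y _; rewrite mulN1r mulNr.
  rewrite segintZ ?(hpsi _ _ tpsi) ?mulr0//; apply: (L1onM ch).
  exact/L1on_cont/continuous_subspaceT/smooth_continuous/trig_poly_smooth/tpsi.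
move=> ch hpsi; exfalso; have [x0 x0I hx0] := pos.
have pi0 := pi_gt0 R.
have [M M0 hM] := within_cont_bounded ch.
have [d d0 hd] := within_unif_continuous ch (divr_gt0 hx0 (ltr0n _ 2)).
(* [x0] may be an end of the period, so the peak is centred at distance [r] from it, towards the
   middle; the window of radius [r] around [c] then stays in the period and close enough to [x0] for
   [h] to exceed [h x0 / 2]. *)
have [c [r [r0 rpi [cr1 cr2] crd]]] : exists c r : R, [/\ 0 < r, r <= pi,
    0 <= c - r /\ c + r <= 2 * pi & forall x, `|x - c| <= r -> `|x0 - x| < d].
  have x0c : 0 <= x0 <= 2 * pi by [].
  pose r := Num.min (d / 3) (pi / 2); exists (if x0 <= pi then x0 + r else x0 - r), r.
  have r0 : 0 < r by rewrite lt_min !divr_gt0.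
  have rd : r <= d / 3 by rewrite ge_min lexx.
  have rpi : r <= pi / 2 by rewrite ge_min lexx orbT.
  split => //; first lra.
    by case: ifP => [x0pi|/negbT]; rewrite -?ltNge; lra.
  move=> x; rewrite ler_norml => /andP[]; case: ifP => _ ? ?.
    by rewrite ltr_norml; apply/andP; split; lra.
  by rewrite ltr_norml; apply/andP; split; lra.
pose m := h x0 / 2; have m0 : 0 < m by rewrite divr_gt0.
have hm x : 0 <= x <= 2 * pi -> `|x - c| <= r -> m <= h x.
  move=> xI /crd xd; have := hd _ _ x0I xI xd.
  by rewrite ltr_norml => /andP[_]; rewrite /m; lra.
pose psi x := (1 - cos r) + cos (x - c).
have tpsi : trig_poly c psi by apply: trig_add; [exact: trig_cst|exact: trig_cos].
have cosle s t : 0 <= s -> s <= t -> t <= pi -> cos t <= cos s.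
  move=> s0; rewrite le_eqVlt => /predU1P[->//|st] tpi.
  by rewrite ltW// ltr_cos ?in_itv//=; lra.
(* The value of [psi] at distance [r / 2] from [c]: it exceeds 1 and bounds [psi] from below on the
   inner window. *)
pose q := 1 - cos r + cos (r / 2).
have q1 : 0 < q - 1.
  have rr : r / 2 < r by lra.
  have : cos r < cos (r / 2) by rewrite ltr_cos ?in_itv//=; lra.
  by rewrite /q; lra.
have psiq x : `|x - c| <= r / 2 -> q <= psi x.
  by move=> xc; rewrite /q /psi lerD2l -(cos_norm (x - c)) cosle//; lra.
have psi1 x : `|x - c| <= r -> 0 <= psi x.
  move=> xc; have : cos r <= cos (x - c) by rewrite -(cos_norm (x - c)) cosle//; lra.
  by rewrite /psi; lra.
have psiN x : r <= `|x - c| -> `|x - c| <= 2 * pi - r -> `|psi x| <= 1.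
  move=> xc xc'; have : cos (x - c) <= cos r.
    have [xpi|xpi] := leP `|x - c| pi.
      by rewrite -(cos_norm (x - c)) cosle//; lra.
    have -> : cos (x - c) = cos (2 * pi - `|x - c|).
      by rewrite -[LHS]cos_norm -[LHS]cosN -cosD2pi mulr_natl addrC.
    by rewrite cosle//; lra.
  have := cos_geN1 (x - c); have := cos_le1 r.
  by rewrite /psi ler_norml => ? ? ?; apply/andP; split; lra.
have low n x : 0 <= x <= 2 * pi -> - M <= h x * psi x ^+ n.
  move=> xI; have [xc|xc] := leP `|x - c| r.
    apply: (@le_trans _ _ 0); first by rewrite oppr_le0 ltW.
    by rewrite mulr_ge0 ?exprn_ge0 ?psi1// (le_trans (ltW m0)) ?hm.
  suff : `|h x * psi x ^+ n| <= M by rewrite ler_norml => /andP[].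
  rewrite normrM normrX -[leRHS]mulr1 ler_pM ?exprn_ge0 ?hM//.
  rewrite exprn_ile1 ?psiN//; first lra.
  by rewrite ler_norml; apply/andP; split; lra.
pose f n x := h x * psi x ^+ n.
have If n : L1on 0 (2 * pi) (f n).
  apply: (L1onM ch); apply/L1on_cont/continuous_subspaceT/smooth_continuous.
  exact/trig_poly_smooth/trig_polyX/tpsi.
have Ic (u v k : R) : L1on u v (fun=> k).
  by apply/L1on_cont/continuous_subspaceT => x; exact: cvg_cst.
(* The inner window contributes at least [m * q ^+ n * r] to the integral of [h * psi ^+ n], and the
   rest at least [- M] times its length, while the total is zero. As [q > 1], this fails for large
   [n]. *)
have key n : (m * q ^+ n) * r <= M * (2 * pi).
  have h01 : 0 <= c - r / 2 by move: cr1 r0; clear; lra.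
  have h12 : c - r / 2 <= c + r / 2 by move: r0; clear; lra.
  have h23 : c + r / 2 <= 2 * pi by move: cr2 r0; clear; lra.
  have E1 := segint_chasles h01 (le_trans h12 h23) (If n).
  have E2 := segint_chasles h12 h23 (L1onS h01 (lexx _) (If n)).
  have E3 : segint 0 (2 * pi) (f n) = 0 by exact: hpsi _ _ (trig_polyX n tpsi).
  have e1 : - M * (c - r / 2 - 0) <= segint 0 (c - r / 2) (f n).
    rewrite -segint_cst//; apply: le_segint => //.
      exact: L1onS (lexx _) (le_trans h12 h23) (If n).
    move=> x /andP[x1 x2]; apply: low.
    by rewrite x1 (le_trans x2)// (le_trans h12).
  have e2 : - M * (2 * pi - (c + r / 2)) <= segint (c + r / 2) (2 * pi) (f n).
    rewrite -segint_cst//; apply: le_segint => //.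
      exact: L1onS (le_trans h01 h12) (lexx _) (If n).
    move=> x /andP[x1 x2]; apply: low.
    by rewrite x2 (le_trans _ x1)// (le_trans h01).
  have e3 : m * q ^+ n * (c + r / 2 - (c - r / 2)) <= segint (c - r / 2) (c + r / 2) (f n).
    rewrite -segint_cst//; apply: le_segint => //; first exact: L1onS (If n).
    move=> x /andP[x1 x2]; have xc : `|x - c| <= r / 2.
      by rewrite ler_norml; apply/andP; split; move: x1 x2; clear; lra.
    have xr : `|x - c| <= r by move: xc r0; clear; lra.
    have q0 : 0 <= q by move: q1; clear; lra.
    apply: ler_pM; [exact: ltW|exact: exprn_ge0| |].
      by apply: hm => //; rewrite (le_trans h01)// (le_trans x2).
    by apply: lerXn2r; rewrite ?nnegrE ?psi1 ?psiq.
  have Mr : 0 < M * r by rewrite mulr_gt0.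
  by move: e1 e2 e3 Mr E1 E2 E3; clear; lra.
pose N := (Num.truncn (M * (2 * pi) / (m * r * (q - 1)))).+1.
have : M * (2 * pi) / (m * r * (q - 1)) < N%:R by exact: truncnS_gt.
rewrite ltr_pdivrMr ?mulr_gt0// => hN.
have := key N; have := one_add_exp N (ltW q1); rewrite [1 + (q - 1)]addrC subrK => h1 h2.
have : m * r * (1 + N%:R * (q - 1)) <= m * r * q ^+ N by rewrite ler_wpM2l// mulr_ge0// ltW.
have : 0 < m * r by rewrite mulr_gt0.
by move: hN h2; clear; lra.
Qed.

End smooth_functions.

(** * Weak derivatives on the circle *)

Section weak_derivatives.
Context {R : realType}.
Local Notation mu := (@lebesgue_measure R).
Local Notation T := (2 * @pi R).
Implicit Types (f g h phi psi : R -> R).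

Lemma twopi_gt0 : 0 < T.
Proof. by rewrite mulr_gt0 ?pi_gt0. Qed.

Lemma circle_integralE f : circle_integral f = segint 0 T f.
Proof. by []. Qed.

Lemma L1on_cst (a b k : R) : L1on a b (fun=> k).
Proof. by apply/L1on_cont/continuous_subspaceT => x; exact: cvg_cst. Qed.

Lemma periodic_at_period f : periodic f T -> f T = f 0.
Proof. by move=> fT; rewrite -{1}[T]add0r fT. Qed.

Lemma circle_test_primitive phi (a b : R) : a <= b -> circle_test phi ->
  primitive_on a b phi (derive1 phi).
Proof.
move=> ab [_ sphi]; apply: primitive_is_derive => //.
  by move=> x; exact/derivable_is_derive1/(smooth_derivable sphi).
exact/smooth_continuous/smooth_derive1.
Qed.

Lemma circle_test_continuous phi : circle_test phi -> continuous phi.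
Proof. by move=> [_ sphi]; exact: smooth_continuous. Qed.

Lemma circle_test_derive1 phi : circle_test phi -> circle_test (derive1 phi).
Proof.
move=> [phiT sphi]; split; last exact: smooth_derive1.
exact/derive1_periodic/phiT/smooth_derivable.
Qed.

Lemma circle_test_cst (k : R) : circle_test (fun=> k).
Proof. by split => //; exact/(@trig_poly_smooth _ 0)/trig_cst. Qed.

Lemma segint_by_parts (a b : R) F G f g : a <= b ->
  primitive_on a b F f -> primitive_on a b G g ->
  segint a b (fun x => F x * g x) =
  F b * G b - F a * G a - segint a b (fun x => f x * G x).
Proof.
move=> ab Ff Gg.
have cF := primitive_within_continuous ab Ff.
have cG := primitive_within_continuous ab Gg.
have [_ /(_ a b (lexx _) ab (lexx _)) ->] := primitiveM ab Ff Gg.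
rewrite segintD; first by ring.
  by apply: eq_L1on (L1onM cG (primitive_L1 Ff)) => x _; rewrite mulrC.
exact: L1onM cF (primitive_L1 Gg).
Qed.

Lemma segint_by_parts_periodic F G f g : F 0 * G 0 = F T * G T ->
  primitive_on 0 T F f -> primitive_on 0 T G g ->
  segint 0 T (fun x => F x * g x) = - segint 0 T (fun x => f x * G x).
Proof.
move=> E Ff Gg; rewrite (segint_by_parts (ltW twopi_gt0) Ff Gg) E subrr.
by rewrite sub0r.
Qed.

Lemma primitive_weak_derivative f g : f 0 = f T -> primitive_on 0 T f g ->
  weak_derivative 1 f g.
Proof.
move=> fT fg; split.
- exact/L1on_cont/(primitive_within_continuous (ltW twopi_gt0) fg).
- exact: primitive_L1 fg.
move=> phi tphi; rewrite expr1 mulN1r.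
apply: segint_by_parts_periodic fg _; last first.
  exact: circle_test_primitive (ltW twopi_gt0) tphi.
by rewrite fT (periodic_at_period tphi.1).
Qed.

Lemma segint_primitive (a b : R) f : L1on a b f ->
  primitive_on a b (fun x => segint a x f) f.
Proof.
move=> If; split => // x y ax xy yb.
by rewrite (segint_chasles ax xy) ?addrK 1?addrC ?addKr//; exact: L1onS If.
Qed.

(** The du Bois-Reymond lemma. The difference [h] of [f] and the integral of [g] is orthogonal to
    derivatives of test functions, hence to trigonometric polynomials of mean zero. So [h] minus its
    mean is orthogonal to all trigonometric polynomials, and vanishes. *)
Lemma weak_derivative_primitive f g : {within `[0, T], continuous f} ->
  weak_derivative 1 f g -> primitive_on 0 T f g.
Proof.
move=> cf [If Ig fg].
have Gg := segint_primitive Ig; set G := (fun x => segint 0 x g) in Gg.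
have T0 := ltW twopi_gt0; have cG := primitive_within_continuous T0 Gg.
(* Testing against the constant 1 shows that [g] has mean zero, so that its primitive takes equal
   values at both ends of the period. *)
have GT : G T = 0.
  have := fg _ (circle_test_cst 1).
  rewrite expr1 mulN1r !circle_integralE.
  rewrite (@eq_segint _ _ _ _ (fun=> 0)); last first.
    by move=> x _; rewrite /= derive1_cst mulr0.
  rewrite segint_cst// mul0r => /esym/eqP; rewrite oppr_eq0 => /eqP E.
  by rewrite -[RHS]E; apply: eq_segint => x _; rewrite mulr1.
have G0 : G 0 = 0 by exact: segintxx.
pose h x := f x - G x.
have ch : {within `[0, T], continuous h} by move=> x; apply: cvgB; [exact: cf|exact: cG].
have Ih := L1on_cont ch.
have hphi phi : circle_test phi -> segint 0 T (fun x => h x * derive1 phi x) = 0.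
  move=> tphi; have phiP := circle_test_primitive T0 tphi.
  have cphi' := circle_test_continuous (circle_test_derive1 tphi).
  have Iphi' : L1on 0 T (derive1 phi) by exact/L1on_cont/continuous_subspaceT.
  rewrite (@eq_segint _ _ _ _ (fun x => f x * derive1 phi x - G x * derive1 phi x)); last first.
    by move=> x _; rewrite mulrBl.
  rewrite segintB; [|exact: (L1onM cf Iphi')|exact: (L1onM cG Iphi')].
  have := fg _ tphi; rewrite expr1 mulN1r !circle_integralE => ->.
  by rewrite (segint_by_parts_periodic _ Gg phiP) ?G0 ?GT ?mul0r// subrr.
pose k := segint 0 T h / T.
have hk : forall x, 0 <= x <= T -> h x - k = 0.
  apply: trig_poly_separates => //.
    by move=> x; apply: cvgB; [exact: ch|exact: cvg_cst].
  move=> a psi tpsi.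
  have cpsi := smooth_continuous (trig_poly_smooth tpsi).
  have Ipsi a' b' : L1on a' b' psi by exact/L1on_cont/continuous_subspaceT.
  (* Subtracting the mean makes the antiderivative of [psi] periodic, hence a test function. *)
  pose M := segint 0 T psi / T.
  have tpsiM : trig_poly a (fun x => psi x + - M) by apply: trig_add => //; exact: trig_cst.
  have cpsiM := smooth_continuous (trig_poly_smooth tpsiM).
  pose phi := antiderivative (fun x => psi x + - M).
  have dphi (x : R) : is_derive x (1 : R) phi (psi x - M) by exact: is_derive_antiderivative.
  have tphi : circle_test phi.
    split; last first.
      exact: (smooth_of_derive1 dphi (trig_poly_smooth tpsiM)).
    move=> x; rewrite /phi antiderivative_periodic//; last exact: trig_poly_periodic tpsiM.
    rewrite segintD ?segint_cst//; last exact: L1on_cst.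
    by rewrite subr0 mulNr /M divfK ?subrr ?addr0// gt_eqF// twopi_gt0.
  have := hphi _ tphi.
  rewrite (@eq_segint _ _ _ _ (fun x => h x * psi x - M * h x)); last first.
    by move=> x _; rewrite (is_derive1_derive1 (dphi x)); ring.
  have Ihpsi := L1onM ch (Ipsi 0 T).
  rewrite segintB ?segintZ//; last exact: L1onZ.
  move=> /eqP; rewrite subr_eq0 => /eqP E.
  rewrite (@eq_segint _ _ _ _ (fun x => h x * psi x - k * psi x)); last first.
    by move=> x _; rewrite mulrBl.
  rewrite segintB ?segintZ// ?E; last exact: L1onZ.
  by rewrite /M /k; ring.
have fE x : 0 <= x <= T -> G x + k = f x.
  by move=> /hk /eqP; rewrite subr_eq0 /h => /eqP <-; ring.
apply: eq_primitive fE _ (primitiveD Gg (primitive_cst _ _ k)).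
by move=> x _; rewrite addr0.
Qed.

Lemma derive1_primitive f (a b : R) : a <= b -> C1 f -> primitive_on a b f (derive1 f).
Proof.
move=> ab [df cf]; apply: primitive_is_derive => // x.
exact: derivable_is_derive1.
Qed.

Lemma segint_derive2 f phi : periodic f T -> C1 f -> circle_test phi ->
  segint 0 T (fun x => f x * derive1 (derive1 phi) x) =
  - segint 0 T (fun x => derive1 f x * derive1 phi x).
Proof.
move=> fT f1 tphi; have tphi' := circle_test_derive1 tphi.
apply: segint_by_parts_periodic.
- by rewrite periodic_at_period// (periodic_at_period tphi'.1).
- exact: derive1_primitive (ltW twopi_gt0) f1.
- exact: circle_test_primitive (ltW twopi_gt0) tphi'.
Qed.

(** One integration by parts turns the second weak derivative of [f] into a first weak derivative of
    the continuous function [derive1 f]. *)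
Lemma sobolev2_primitive f : C1 f -> sobolev_k2 2 f ->
  exists2 g, L2on 0 T g & primitive_on 0 T (derive1 f) g.
Proof.
move=> f1 [fT _ /(_ 2 (leqnn _))[g g2 [_ Ig fg]]].
have cf' : {within `[0, T], continuous (derive1 f)} by apply/continuous_subspaceT/f1.2.
exists g => //; apply: weak_derivative_primitive => //; split => //.
  exact: L1on_cont.
move=> phi tphi; have := fg _ tphi.
rewrite expr1 mulN1r sqrrN expr1n mul1r => <-.
by apply: oppr_inj; rewrite opprK; apply: esym; exact: segint_derive2.
Qed.

Lemma sobolev2_of_primitive f g : periodic f T -> C1 f ->
  L2on 0 T g -> primitive_on 0 T (derive1 f) g -> sobolev_k2 2 f.
Proof.
move=> fT f1 g2 f'g.
have T0 := ltW twopi_gt0.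
have cf : {within `[0, T], continuous f}.
  exact/continuous_subspaceT/derivable1_continuous/f1.1.
have cf' : {within `[0, T], continuous (derive1 f)} by apply/continuous_subspaceT/f1.2.
have f'T : derive1 f 0 = derive1 f T.
  by rewrite (periodic_at_period (derive1_periodic f1.1 fT)).
split => //; first exact: L2on_cont.
move=> [|[|[|//]]] _.
- exists f; first exact: L2on_cont.
  by split; [exact: L1on_cont|exact: L1on_cont|move=> phi _; rewrite expr0 mul1r].
- exists (derive1 f); first exact: L2on_cont.
  apply: primitive_weak_derivative; first by rewrite periodic_at_period.
  exact: derive1_primitive.
- exists g => //; split; [exact: L1on_cont|exact: primitive_L1 f'g|].
  move=> phi tphi; rewrite sqrrN expr1n mul1r.
  have [_ _ /(_ _ tphi)] := primitive_weak_derivative f'T f'g.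
  rewrite expr1 mulN1r => E; apply: etrans (segint_derive2 fT f1 tphi) _.
  by apply: oppr_inj; rewrite opprK.
Qed.

End weak_derivatives.

(** * Sobolev functions of order one on a segment *)

Section H1.
Context {R : realType}.
Implicit Types (a b c x y : R) (f g h m F G : R -> R).

(** The space W^{1,2}, through the continuous representative [F] and a chosen weak derivative
    [f]. *)
Definition H1on a b F f : Prop := L2on a b f /\ primitive_on a b F f.

Lemma H1on_continuous a b F f : a <= b -> H1on a b F f ->
  {within `[a, b], continuous F}.
Proof. by move=> ab [_ Ff]; exact: primitive_within_continuous Ff. Qed.

Lemma eq_H1on a b F G f g :
  (forall x, a <= x <= b -> F x = G x) -> (forall x, a <= x <= b -> f x = g x) ->
  H1on a b F f -> H1on a b G g.
Proof.
by move=> FG fg [f2 Ff]; split; [exact: eq_L2on fg f2|exact: eq_primitive Ff].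
Qed.

Lemma H1on_cst a b c : H1on a b (fun=> c) (fun=> 0).
Proof.
split; last exact: primitive_cst.
by apply: L2on_cont; apply: continuous_subspaceT => x; exact: cvg_cst.
Qed.

Lemma H1onD a b F G f g : H1on a b F f -> H1on a b G g ->
  H1on a b (fun x => F x + G x) (fun x => f x + g x).
Proof. by move=> [? ?] [? ?]; split; [exact: L2onD|exact: primitiveD]. Qed.

Lemma H1onN a b F f : H1on a b F f -> H1on a b (fun x => - F x) (fun x => - f x).
Proof. by move=> [? ?]; split; [exact: L2onN|exact: primitiveN]. Qed.

Lemma H1onB a b F G f g : H1on a b F f -> H1on a b G g ->
  H1on a b (fun x => F x - G x) (fun x => f x - g x).
Proof. by move=> Ff Gg; exact: H1onD (H1onN Gg). Qed.

Lemma H1onM a b F G f g : a <= b -> H1on a b F f -> H1on a b G g ->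
  H1on a b (fun x => F x * G x) (fun x => f x * G x + F x * g x).
Proof.
move=> ab Ff Gg; split; last exact: primitiveM Ff.2 Gg.2.
apply: L2onD; last exact: L2onM (H1on_continuous ab Ff) Gg.1.
apply: eq_L2on (L2onM (H1on_continuous ab Gg) Ff.1) => x _.
by rewrite mulrC.
Qed.

Lemma H1onZ a b k F f : a <= b -> H1on a b F f ->
  H1on a b (fun x => k * F x) (fun x => k * f x).
Proof.
move=> ab Ff; apply: eq_H1on (H1onM ab (H1on_cst a b k) Ff) => x _ //.
by rewrite mul0r add0r.
Qed.

Lemma H1on_comp a b F f (Phi phi : R -> R) : a <= b -> H1on a b F f ->
  (forall x, a <= x <= b -> is_derive (F x) 1 Phi (phi (F x))) ->
  {within `[a, b], continuous (phi \o F)} ->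
  H1on a b (fun x => Phi (F x)) (fun x => phi (F x) * f x).
Proof.
move=> ab Ff dPhi cphi; split; last exact: (primitive_comp ab Ff.2 dPhi cphi).
exact: (L2onM cphi Ff.1).
Qed.

Lemma H1on_is_derive a b F f : a <= b ->
  (forall x, is_derive x 1 F (f x)) -> continuous f -> H1on a b F f.
Proof.
move=> ab dF cf; split; last exact: primitive_is_derive.
exact/L2on_cont/continuous_subspaceT.
Qed.

Lemma within_continuousV a b F : {within `[a, b], continuous F} ->
  (forall x, a <= x <= b -> F x != 0) -> {within `[a, b], continuous (fun x => (F x)^-1)}.
Proof.
move=> cF F0; apply/subspace_continuousP => x xab.
apply: cvgV; last by move/subspace_continuousP : cF; apply.
by apply: F0; move: xab; rewrite /= in_itv.
Qed.

Lemma H1on_inv a b F f : a <= b -> H1on a b F f ->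
  (forall x, a <= x <= b -> F x != 0) ->
  H1on a b (fun x => (F x)^-1) (fun x => - (F x) ^- 2 * f x).
Proof.
move=> ab Ff F0; have cF := H1on_continuous ab Ff.
apply: (@H1on_comp _ _ _ _ (fun y => y^-1) (fun y => - y ^- 2)) => //.
  move=> x xab; have := @is_deriveV _ id (F x) 1 1 (F0 x xab) (is_derive_id _ _).
  by rewrite /GRing.scale/= mulr1.
suff cV : {within `[a, b], continuous (fun x => (F x * F x)^-1)}.
  by move=> x; apply: cvgN; exact: cV.
apply: within_continuousV; first by move=> y; apply: cvgM; exact: cF.
by move=> y /F0 Fy; rewrite mulf_neq0.
Qed.

Lemma H1on_sqrt a b F f : a <= b -> H1on a b F f ->
  (forall x, a <= x <= b -> 0 < F x) ->
  H1on a b (fun x => Num.sqrt (F x)) (fun x => (2 * Num.sqrt (F x))^-1 * f x).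
Proof.
move=> ab Ff F0; have cF := H1on_continuous ab Ff.
apply: (@H1on_comp _ _ _ _ Num.sqrt (fun y => (2 * Num.sqrt y)^-1)) => //.
  by move=> x /F0 Fx0; exact: is_derive1_sqrt.
apply: within_continuousV.
  move=> x; apply: cvgM; first exact: cvg_cst.
  by apply: continuous_comp (cF x) _; exact: sqrt_continuous.
by move=> x /F0 Fx; rewrite mulf_neq0// gt_eqF// sqrtr_gt0.
Qed.

(** [m] is the derivative of the polar angle of [(F, G)], written without choosing an angle: the
    normalized field turns at rate [m]. It is square integrable as a combination of [f] and [g] with
    continuous coefficients. *)
Lemma H1on_normalize a b F G f g : a <= b -> H1on a b F f -> H1on a b G g ->
  (forall x, a <= x <= b -> 0 < F x * F x + G x * G x) ->
  let r x := Num.sqrt (F x * F x + G x * G x) in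
  let m x := (F x * g x - G x * f x) / (F x * F x + G x * G x) in
  [/\ exists f', H1on a b r f', L2on a b m,
      H1on a b (fun x => F x / r x) (fun x => - (m x * (G x / r x))) &
      H1on a b (fun x => G x / r x) (fun x => m x * (F x / r x))].
Proof.
move=> ab Ff Gg FG0 r m.
have u1 := H1onD (H1onM ab Ff Ff) (H1onM ab Gg Gg).
have r1 := H1on_sqrt ab u1 FG0.
have r0 x : a <= x <= b -> 0 < r x by move=> /FG0 ?; rewrite sqrtr_gt0.
have rE x : a <= x <= b -> F x * F x + G x * G x = r x ^+ 2.
  by move=> /FG0 ?; rewrite sqr_sqrtr// ltW.
have ri1 := H1on_inv ab r1 (fun x xab => lt0r_neq0 (r0 x xab)).
have Fr1 := H1onM ab Ff ri1.
have Gr1 := H1onM ab Gg ri1.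
have rB x : a <= x <= b -> r x != 0 by move=> /r0 /lt0r_neq0.
split.
- by eexists; exact: r1.
- have FC : {within `[a, b], continuous (fun x => F x / r x / r x)}.
    exact: H1on_continuous ab (H1onM ab Fr1 ri1).
  have GC : {within `[a, b], continuous (fun x => - (G x / r x / r x))}.
    exact: H1on_continuous ab (H1onN (H1onM ab Gr1 ri1)).
  apply: eq_L2on (L2onD (L2onM FC Gg.1) (L2onM GC Ff.1)) => x xab.
  by rewrite /m rE//; field; exact: rB.
- apply: eq_H1on Fr1 => // x xab; rewrite -/(r x) /m rE//.
  have rx := rB x xab; rewrite [f x / r x](_ : _ = f x * r x ^+ 2 / r x ^+ 3); last by field.
  by rewrite -{1}rE//; field.
- apply: eq_H1on Gr1 => // x xab; rewrite -/(r x) /m rE//.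
  have rx := rB x xab; rewrite [g x / r x](_ : _ = g x * r x ^+ 2 / r x ^+ 3); last by field.
  by rewrite -{1}rE//; field.
Qed.

End H1.

(** * Curvature and winding number *)

Section curves.
Context {R : realType}.
Local Notation mu := (@lebesgue_measure R).
Local Notation T := (2 * @pi R).
Implicit Types (gamma : R -> R * R) (m f g : R -> R).

Lemma ae_eq_segint (a b : R) f g :
  measurable_fun `[a, b] f -> measurable_fun `[a, b] g ->
  {ae mu, forall x, a <= x <= b -> f x = g x} -> segint a b f = segint a b g.
Proof.
move=> mf mg fg; congr fine; apply: ae_eq_integral => //.
- exact/measurable_EFinP.
- exact/measurable_EFinP.
apply: filterS fg; first exact: (ae_filter_ringOfSetsType mu).
by move=> x /= fg; rewrite in_itv/= => /fg ->.
Qed.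

Definition xcoord gamma : R -> R := fst \o gamma.
Definition ycoord gamma : R -> R := snd \o gamma.
Definition xvel gamma : R -> R := derive1 (xcoord gamma).
Definition yvel gamma : R -> R := derive1 (ycoord gamma).

Lemma speedE gamma x :
  speed gamma x = Num.sqrt (xvel gamma x * xvel gamma x + yvel gamma x * yvel gamma x).
Proof. by []. Qed.

Section immersed.
Variable gamma : R -> R * R.
Hypothesis imm : W22Imm gamma.
Local Notation X := (xcoord gamma).
Local Notation Y := (ycoord gamma).
Local Notation p := (xvel gamma).
Local Notation q := (yvel gamma).
Local Notation v := (speed gamma).
Local Notation t1 := (fun x => (tau gamma x).1).
Local Notation t2 := (fun x => (tau gamma x).2).

Let T0 : 0 <= T. Proof. exact/ltW/twopi_gt0. Qed.

Lemma xcoord_C1 : C1 X. Proof. by case: imm. Qed.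
Lemma ycoord_C1 : C1 Y. Proof. by case: imm. Qed.
Lemma xcoord_periodic : periodic X T. Proof. by case: imm => -[]. Qed.
Lemma ycoord_periodic : periodic Y T. Proof. by case: imm => _ -[]. Qed.

Lemma xvel_continuous : continuous p. Proof. exact: xcoord_C1.2. Qed.
Lemma yvel_continuous : continuous q. Proof. exact: ycoord_C1.2. Qed.

Lemma xvel_periodic : periodic p T.
Proof. exact: derive1_periodic xcoord_C1.1 xcoord_periodic. Qed.

Lemma yvel_periodic : periodic q T.
Proof. exact: derive1_periodic ycoord_C1.1 ycoord_periodic. Qed.

Lemma vel_gt0 x : 0 < p x * p x + q x * q x.
Proof.
have := sqr_ge0 (p x); have := sqr_ge0 (q x); rewrite -!expr2 => q0 p0.
rewrite lt0r addr_ge0// andbT paddr_eq0// !expf_eq0/=.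
apply/negP => /andP[/eqP px /eqP qx].
by case: imm => _ _ _ _ /(_ x); apply; congr pair.
Qed.

Lemma speed_gt0 x : 0 < v x.
Proof. by rewrite speedE sqrtr_gt0 vel_gt0. Qed.

Lemma speed_sqr x : v x ^+ 2 = p x * p x + q x * q x.
Proof. by rewrite speedE sqr_sqrtr// ltW// vel_gt0. Qed.

Lemma speed_continuous : continuous v.
Proof.
move=> x.
suff : {for x, continuous (Num.sqrt \o (fun x => p x * p x + q x * q x))} by [].
apply: continuous_comp; last exact: sqrt_continuous.
by apply: cvgD; apply: cvgM; [exact: xvel_continuous..|exact: yvel_continuous|exact: yvel_continuous].
Qed.

Lemma speed_periodic : periodic v T.
Proof. by move=> x; rewrite !speedE xvel_periodic yvel_periodic. Qed.

Lemma xvel_tau x : p x = v x * t1 x.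
Proof. by rewrite /tau/= mulrC divfK// gt_eqF// speed_gt0. Qed.

Lemma yvel_tau x : q x = v x * t2 x.
Proof. by rewrite /tau/= mulrC divfK// gt_eqF// speed_gt0. Qed.

Lemma tau_unit x : t1 x * t1 x + t2 x * t2 x = 1.
Proof.
have v0 := lt0r_neq0 (speed_gt0 x).
rewrite /tau/= -!/(xvel gamma x) -!/(yvel gamma x).
rewrite [LHS](_ : _ = (p x * p x + q x * q x) / v x ^+ 2); last by field.
by rewrite -speed_sqr divff// expf_neq0.
Qed.

Lemma tau1_continuous : continuous t1.
Proof.
move=> x; apply: cvgM; first exact: xvel_continuous.
by apply: cvgV; [exact/lt0r_neq0/speed_gt0|exact: speed_continuous].
Qed.

Lemma tau2_continuous : continuous t2.
Proof.
move=> x; apply: cvgM; first exact: yvel_continuous.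
by apply: cvgV; [exact/lt0r_neq0/speed_gt0|exact: speed_continuous].
Qed.

Lemma tau1_periodic : periodic t1 T.
Proof. by move=> x; rewrite /tau/= speed_periodic -/(xvel gamma _) xvel_periodic. Qed.

Lemma tau2_periodic : periodic t2 T.
Proof. by move=> x; rewrite /tau/= speed_periodic -/(yvel gamma _) yvel_periodic. Qed.

Lemma curve_lengthE : curve_length gamma = segint 0 T v.
Proof. by apply: eq_segint => x _; rewrite mul1r. Qed.

Lemma algebraic_areaE :
  algebraic_area gamma = 1 / 2 * segint 0 T (fun x => X x * q x - Y x * p x).
Proof.
rewrite /algebraic_area /integral_ds circle_integralE mulNr -mulrN; congr (_ * _).
rewrite -[LHS]mulN1r -segintZ.
  apply: eq_segint => x _; rewrite /nu /dot/= [q x]yvel_tau [p x]xvel_tau.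
  by rewrite /X /Y /xcoord /ycoord/=; ring.
have cX : continuous X := derivable1_continuous xcoord_C1.1.
have cY : continuous Y := derivable1_continuous ycoord_C1.1.
apply: L1on_cont; apply: continuous_subspaceT => x.
apply: cvgM; last exact: speed_continuous.
apply: cvgD; apply: cvgM.
- by apply: cvgN; exact: tau2_continuous.
- exact: cX.
- exact: tau1_continuous.
- exact: cY.
Qed.

Lemma curve_length_gt0 : 0 < curve_length gamma.
Proof.
have cv : {within `[0, T], continuous v} by exact/continuous_subspaceT/speed_continuous.
have [c cI vc] := EVT_min T0 cv.
rewrite curve_lengthE; apply: (@lt_le_trans _ _ (segint 0 T (fun=> v c))).
  by rewrite segint_cst// mulr_gt0 ?speed_gt0// subr0 twopi_gt0.
apply: le_segint; [exact: L1on_cst|exact: L1on_cont|].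
by move=> x xI; apply: vc; rewrite in_itv.
Qed.

(* The weak derivative m of the tangent angle, that is m = |gamma'| kappa. *)
Definition angular_speed m : Prop :=
  [/\ L2on 0 T m, H1on 0 T t1 (fun x => - (m x * t2 x)) &
      H1on 0 T t2 (fun x => m x * t1 x)].

(** The tangent is the normalized velocity, whose components lie in W^{1,2}. The regularity of the
    speed is kept because the velocity of a perturbed curve has the speed as a factor. *)
Lemma angular_speed_exists :
  (exists v', H1on 0 T v v') /\ exists m, angular_speed m.
Proof.
have [sX sY cX cY _] := imm.
have [g1 g12 g1P] := sobolev2_primitive cX sX.
have [g2 g22 g2P] := sobolev2_primitive cY sY.
have /(_ _)[|v1 m2 m3 m4] :=
  H1on_normalize T0 (conj g12 g1P) (conj g22 g2P); first by move=> x _; exact: vel_gt0.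
by split => //; eexists; split; [exact: m2|exact: m3|exact: m4].
Qed.

Lemma is_curvature_angular m : angular_speed m -> is_curvature gamma (fun x => m x / v x).
Proof.
move=> [_ [_ m1] [_ m2]]; split; apply: primitive_weak_derivative.
- by rewrite (periodic_at_period tau1_periodic).
- apply: eq_primitive m1 => // x _; rewrite /nu/=.
  by have := lt0r_neq0 (speed_gt0 x) => ?; field.
- by rewrite (periodic_at_period tau2_periodic).
- apply: eq_primitive m2 => // x _; rewrite /nu/=.
  by have := lt0r_neq0 (speed_gt0 x) => ?; field.
Qed.

(** The curvature is an arbitrary choice, so even its measurability must be read off from the weak
    derivatives of the tangent. Pairing these with the unit normal gives speed times curvature, and
    their almost everywhere uniqueness identifies it with [m]. *)
Lemma curvature_ae m : angular_speed m ->
  measurable_fun `[0, T] (curvature gamma) /\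
  {ae mu, forall x, 0 <= x <= T -> curvature gamma x = m x / v x}.
Proof.
move=> mP; have kP : is_curvature gamma (curvature gamma).
  exact: xgetPex (ex_intro _ _ (is_curvature_angular mP)).
have [w1 w2] := kP; have [_ [_ m1] [_ m2]] := mP.
have k1 := weak_derivative_primitive (continuous_subspaceT tau1_continuous) w1.
have k2 := weak_derivative_primitive (continuous_subspaceT tau2_continuous) w2.
split.
  have mc (h : R -> R) : continuous h -> measurable_fun `[0, T] h.
    by move=> ch; exact: within_cont_measurable (continuous_subspaceT ch).
  have mvi : measurable_fun `[0, T] (fun x => (v x)^-1).
    apply: mc => x; apply: cvgV; [exact/lt0r_neq0/speed_gt0|exact: speed_continuous].
  have := measurable_funM (measurable_funB
    (measurable_funM (L1on_measurable (primitive_L1 k2)) (mc _ tau1_continuous))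
    (measurable_funM (L1on_measurable (primitive_L1 k1)) (mc _ tau2_continuous))) mvi.
  apply: eq_measurable_fun => x _ /=; rewrite /nu/=.
  have v0 := lt0r_neq0 (speed_gt0 x).
  rewrite [LHS](_ : _ = curvature gamma x * (t1 x * t1 x + t2 x * t2 x)).
    by rewrite tau_unit mulr1.
  by rewrite /tau/=; field.
have := primitive_ae_unique k1 m1; have := primitive_ae_unique k2 m2.
apply: filterS2; first exact: (ae_filter_ringOfSetsType mu).
move=> x /[swap] + + xI => /(_ xI) E1 /(_ xI) E2.
have v0 := lt0r_neq0 (speed_gt0 x); apply: (mulfI v0).
have aux (a b V K M : R) : a * a + b * b = 1 ->
    V * (K * - b) = - (M * b) -> V * (K * a) = M * a -> V * K = M.
  move=> ab Eb Ea; rewrite -[LHS]mulr1 -[M]mulr1 -ab.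
  rewrite [LHS](_ : _ = (V * (K * a)) * a - (V * (K * - b)) * b); last by ring.
  by rewrite Ea Eb; ring.
by rewrite mulrCA divff// mulr1; exact: aux (tau_unit x) E1 E2.
Qed.

Lemma angular_speed_measurable m : angular_speed m ->
  measurable_fun `[0, T] m /\ L1on 0 T (fun x => m x ^+ 2 / v x).
Proof.
move=> [[mm Im2] _ _]; split => //.
have cvi : {within `[0, T], continuous (fun x => (v x)^-1)}.
  apply: continuous_subspaceT => x.
  by apply: cvgV; [exact/lt0r_neq0/speed_gt0|exact: speed_continuous].
by apply: eq_L1on (L1onM cvi Im2) => x _; rewrite mulrC.
Qed.

Lemma bending_energyE m : angular_speed m ->
  bending_energy gamma = segint 0 T (fun x => m x ^+ 2 / v x).
Proof.
move=> mP; have [mk km] := curvature_ae mP.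
have [_ /L1on_measurable mm2] := angular_speed_measurable mP.
apply: ae_eq_segint => //.
  apply: measurable_funM; first exact: measurable_funX.
  exact: (within_cont_measurable (continuous_subspaceT speed_continuous)).
apply: filterS km; first exact: (ae_filter_ringOfSetsType mu).
move=> x + xI => /(_ xI) ->.
by have v0 := lt0r_neq0 (speed_gt0 x); field.
Qed.

Lemma winding_numberE m : angular_speed m ->
  winding_number gamma = T^-1 * segint 0 T m.
Proof.
move=> mP; have [mk km] := curvature_ae mP; congr (_ * _).
have [mm _] := angular_speed_measurable mP.
apply: ae_eq_segint => //.
  apply: measurable_funM => //.
  exact: (within_cont_measurable (continuous_subspaceT speed_continuous)).
apply: filterS km; first exact: (ae_filter_ringOfSetsType mu).
move=> x + xI => /(_ xI) ->.
by have v0 := lt0r_neq0 (speed_gt0 x); rewrite divfK.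
Qed.

Lemma bending_energy_ge0 : 0 <= bending_energy gamma.
Proof.
have [_ [m mP]] := angular_speed_exists.
rewrite (bending_energyE mP); apply: segint_ge0 => x _.
by rewrite divr_ge0 ?sqr_ge0// ltW// speed_gt0.
Qed.

End immersed.

Lemma W22Imm_of_H1 (X Y : R -> R) g1 g2 :
  periodic X T -> periodic Y T -> C1 X -> C1 Y ->
  H1on 0 T (derive1 X) g1 -> H1on 0 T (derive1 Y) g2 ->
  (forall x, 0 < derive1 X x * derive1 X x + derive1 Y x * derive1 Y x) ->
  W22Imm (fun x => (X x, Y x)).
Proof.
move=> XT YT X1 Y1 [g12 Xg] [g22 Yg] XY0; split => //.
- exact: sobolev2_of_primitive g12 Xg.
- exact: sobolev2_of_primitive g22 Yg.
move=> x [X0 Y0]; have := XY0 x.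
by rewrite [derive1 X x]X0 [derive1 Y x]Y0 mulr0 addr0 ltxx.
Qed.

(** The right side is the derivative of the arctangent of cross product over dot product of [(a, b)]
    and [(c, d)], the left side the difference of their angular speeds. They agree by Lagrange's
    identity: the squares of the cross and dot products add up to the product of the squared
    norms. *)
Lemma atan_quotient_derive (a b c d a' b' c' d' : R) :
  0 < a * a + b * b -> 0 < c * c + d * d -> 0 < a * c + b * d ->
  (c * d' - d * c') / (c * c + d * d) - (a * b' - b * a') / (a * a + b * b) =
  (1 + ((a * d - b * c) / (a * c + b * d)) ^+ 2)^-1 *
  ((a' * d + a * d' - (b' * c + b * c')) / (a * c + b * d) + (a * d - b * c) *
   (- (a * c + b * d) ^- 2 * (a' * c + a * c' + (b' * d + b * d')))).
Proof.
move=> aa cc D0.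
have PQ : (a * c + b * d) ^+ 2 + (a * d - b * c) ^+ 2 =
  (a * a + b * b) * (c * c + d * d) by ring.
have PQ0 : (a * c + b * d) ^+ 2 + (a * d - b * c) ^+ 2 != 0.
  by rewrite PQ mulf_neq0// lt0r_neq0.
rewrite [RHS](_ : _ = ((a' * d + a * d' - (b' * c + b * c')) * (a * c + b * d) -
  (a * d - b * c) * (a' * c + a * c' + (b' * d + b * d'))) /
  ((a * c + b * d) ^+ 2 + (a * d - b * c) ^+ 2)); last first.
  by field; rewrite PQ0 lt0r_neq0.
rewrite PQ; field; rewrite !lt0r_neq0//.
Qed.

(* Two nowhere vanishing closed fields at an angle less than pi / 2 rotate by
   the same total angle: the angle between them is the periodic function
   atan (cross / dot). *)
Lemma rotation_eq (a b c d a' b' c' d' : R -> R) :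
  H1on 0 T a a' -> H1on 0 T b b' -> H1on 0 T c c' -> H1on 0 T d d' ->
  a T = a 0 -> b T = b 0 -> c T = c 0 -> d T = d 0 ->
  (forall x, 0 <= x <= T -> 0 < a x * c x + b x * d x) ->
  segint 0 T (fun x => (a x * b' x - b x * a' x) / (a x * a x + b x * b x)) =
  segint 0 T (fun x => (c x * d' x - d x * c' x) / (c x * c x + d x * d x)).
Proof.
have T0 : 0 <= T by exact/ltW/twopi_gt0.
move=> a1 b1 c1 d1 aT bT cT dT abcd.
have ab0 x : 0 <= x <= T -> 0 < a x * a x + b x * b x.
  move=> xI; rewrite lt0r addr_ge0 -?expr2 ?sqr_ge0// andbT paddr_eq0 ?sqr_ge0//.
  rewrite !expf_eq0/=; apply/negP => /andP[/eqP ax /eqP bx].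
  by have := abcd x xI; rewrite ax bx !mul0r addr0 ltxx.
have cd0 x : 0 <= x <= T -> 0 < c x * c x + d x * d x.
  move=> xI; rewrite lt0r addr_ge0 -?expr2 ?sqr_ge0// andbT paddr_eq0 ?sqr_ge0//.
  rewrite !expf_eq0/=; apply/negP => /andP[/eqP cx /eqP dx].
  by have := abcd x xI; rewrite cx dx !mulr0 addr0 ltxx.
have [_ m1 _ _] := H1on_normalize T0 a1 b1 ab0.
have [_ m2 _ _] := H1on_normalize T0 c1 d1 cd0.
have C1 := H1onB (H1onM T0 a1 d1) (H1onM T0 b1 c1).
have D1 := H1onD (H1onM T0 a1 c1) (H1onM T0 b1 d1).
have Di := H1on_inv T0 D1 (fun x xI => lt0r_neq0 (abcd x xI)).
have Q1 := H1onM T0 C1 Di.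
have cQ := H1on_continuous T0 Q1.
have A1 := @H1on_comp _ _ _ _ _ atan (fun y => (1 + y ^+ 2)^-1) T0 Q1
  (fun x _ => is_derive1_atan _).
have [|_ [_ /(_ 0 T (lexx _) T0 (lexx _))]] := A1.
  apply: within_continuousV.
    move=> x; apply: cvgD; first exact: cvg_cst.
    by apply: cvgM; exact: cQ.
  by move=> x _; rewrite lt0r_neq0// ltr_pwDl// sqr_ge0.
rewrite aT bT cT dT subrr => /esym E.
apply/eqP; rewrite -subr_eq0 -oppr_eq0 opprB -segintB; [|exact: L2on_L1..].
rewrite -[X in _ == X]E; apply/eqP/eq_segint => x xI.
exact: atan_quotient_derive (ab0 x xI) (cd0 x xI) (abcd x xI).
Qed.

End curves.

(** The end of a Cauchy-Schwarz argument: [k] is the ratio of the perturbed length to the length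
    [l], and the hypothesis is an integrated Young inequality, to be multiplied by [l]. *)
Lemma sqr_le_of_young {R : realType} (k l u eps b a : R) :
  0 < l -> u * l = a -> 2 * k * (k * l) <= (1 + u ^+ 2 + k ^+ 2) * l + 2 * u * eps * b ->
  (k * l) ^+ 2 <= l ^+ 2 + 2 * a * (eps * b) + a ^+ 2.
Proof.
move=> l0 <- H.
have {}H : k ^+ 2 * l <= l * (1 + u ^+ 2) + 2 * u * (eps * b) by move: H; clear; lra.
have := ler_wpM2r (ltW l0) H; clear; lra.
Qed.

Lemma segint_lincomb {R : realType} (a b t s : R) (f g h k v : R -> R) :
  L1on a b f -> L1on a b g -> L1on a b h -> L1on a b k -> L1on a b v ->
  segint a b (fun x => f x + (t * ((g x - h x) + k x) + s * v x)) =
  segint a b f + (t * ((segint a b g - segint a b h) + segint a b k) + s * segint a b v).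
Proof.
move=> If Ig Ih Ik Iv.
have I1 := L1onB Ig Ih; have I2 := L1onD I1 Ik.
rewrite (segintD If (L1onD (L1onZ t I2) (L1onZ s Iv))).
rewrite (segintD (L1onZ t I2) (L1onZ s Iv)) (segintZ t I2) (segintZ s Iv).
by rewrite (segintD I1 Ik) (segintB Ig Ih).
Qed.

(* The reverse triangle inequality for the norms a and b of two planar vectors
   tau + s n and tau + t n, where tau, n are unit vectors with tau.n = z. *)
Lemma dist_of_sqr {R : realType} (a b s t z : R) : 0 <= a -> 0 <= b ->
  a ^+ 2 = 1 + 2 * s * z + s ^+ 2 -> b ^+ 2 = 1 + 2 * t * z + t ^+ 2 -> `|z| <= 1 ->
  `|a - b| <= `|s - t|.
Proof.
move=> a0 b0 Ea Eb z1.
have z2 : 0 <= 1 - z ^+ 2.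
  by rewrite subr_ge0 -[z ^+ 2]real_normK ?num_real// exprn_ile1.
rewrite -(@ler_pXn2r _ 2) ?nnegrE// !real_normK ?num_real//.
have ab : 1 + (s + t) * z + s * t <= a * b.
  have [neg|pos] := leP (1 + (s + t) * z + s * t) 0.
    by apply: le_trans neg _; exact: mulr_ge0.
  rewrite -(@ler_pXn2r _ 2) ?nnegrE ?mulr_ge0// ?(ltW pos)// exprMn Ea Eb.
  rewrite -subr_ge0 [leRHS](_ : _ = (s - t) ^+ 2 * (1 - z ^+ 2)); last by ring.
  by rewrite mulr_ge0// sqr_ge0.
rewrite [leLHS](_ : _ = a ^+ 2 + b ^+ 2 - 2 * (a * b)); last by ring.
by rewrite Ea Eb; lra.
Qed.

(** * Adding a circle to a curve *)

Section continuous_functions.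
Context {R : realType}.
Implicit Types (f g : R -> R).

Lemma continuousMf (f g : R -> R) : continuous f -> continuous g ->
  continuous (fun x => f x * g x).
Proof. by move=> cf cg x; apply: cvgM; [exact: cf|exact: cg]. Qed.

Lemma continuousDf (f g : R -> R) : continuous f -> continuous g ->
  continuous (fun x => f x + g x).
Proof. by move=> cf cg x; apply: cvgD; [exact: cf|exact: cg]. Qed.

Lemma continuousNf (f : R -> R) : continuous f -> continuous (fun x => - f x).
Proof. by move=> cf x; apply: cvgN; exact: cf. Qed.

Lemma continuousZf k (f : R -> R) : continuous f -> continuous (fun x => k * f x).
Proof. by move=> cf x; apply: cvgM; [exact: cvg_cst|exact: cf]. Qed.

Lemma L1on_continuous a b (f : R -> R) : continuous f -> L1on a b f.
Proof. by move=> cf; exact: L1on_cont (continuous_subspaceT cf). Qed.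

End continuous_functions.

Section perturbation.
Context {R : realType}.
Local Notation T := (2 * @pi R).
Variables (gamma : R -> R * R) (e eps : R).
Hypothesis imm : W22Imm gamma.
Hypotheses (e2 : e * e = 1) (eps2 : eps * eps = 1).
Local Notation X := (xcoord gamma).
Local Notation Y := (ycoord gamma).
Local Notation p := (xvel gamma).
Local Notation q := (yvel gamma).
Local Notation v := (speed gamma).
Local Notation t1 := (fun x => (tau gamma x).1).
Local Notation t2 := (fun x => (tau gamma x).2).
Local Notation L := (curve_length gamma).
Local Notation c := (T / L).

(* The arc length parameter, rescaled to the length T of the circle. *)
Definition arc_angle (x : R) : R := c * antiderivative v x.

(** The sign [e] selects one of two opposite phases, and [eps] the orientation of the unit circle
    [w]. *)
Definition wx (x : R) : R := e * cos (arc_angle x).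
Definition wy (x : R) : R := eps * (e * sin (arc_angle x)).
(** [(nx, ny)] is the derivative of [w] with respect to [arc_angle], a quarter turn of [w] in the
    direction given by [eps]. *)
Definition nx (x : R) : R := - (eps * wy x).
Definition ny (x : R) : R := eps * wx x.

Definition perturb (t x : R) : R * R := (X x + t * wx x, Y x + t * wy x).

(* The velocity of the perturbed curve is v (ux, uy). *)
Definition ux (t x : R) : R := (tau gamma x).1 + t * c * nx x.
Definition uy (t x : R) : R := (tau gamma x).2 + t * c * ny x.
Definition unorm (t x : R) : R := Num.sqrt (ux t x * ux t x + uy t x * uy t x).

(** The integral B of det (w, gamma'). It is the first variation of the area along [w] and, up to
    the factor [eps * c], that of the length. *)
Definition flux : R := segint 0 T (fun x => wx x * q x - wy x * p x).

Let T0 : 0 <= T. Proof. exact/ltW/twopi_gt0. Qed.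
Let L0 : 0 < L. Proof. exact: curve_length_gt0. Qed.
Let c0 : 0 < c. Proof. by rewrite divr_gt0 ?twopi_gt0. Qed.
Let cL : c * L = T. Proof. by rewrite divfK// gt_eqF. Qed.

Let cv : continuous v. Proof. exact: speed_continuous. Qed.

Lemma is_derive_arc_angle (x : R) : is_derive x 1 arc_angle (c * v x).
Proof. by apply: is_derive1Z; exact: is_derive_antiderivative. Qed.

Lemma arc_angle_period x : arc_angle (x + T) = arc_angle x + pi *+ 2.
Proof.
rewrite /arc_angle antiderivative_periodic//; last exact: speed_periodic.
by rewrite mulrDr -curve_lengthE// cL mulr_natl.
Qed.

Lemma wx_periodic : periodic wx T.
Proof. by move=> x; rewrite /wx arc_angle_period cosD2pi. Qed.

Lemma wy_periodic : periodic wy T.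
Proof. by move=> x; rewrite /wy arc_angle_period sinD2pi. Qed.

Lemma is_derive_wx (x : R) : is_derive x 1 wx (c * (v x * nx x)).
Proof.
have := is_derive1Z e (is_derive1_comp (is_derive_arc_angle x) (is_derive_cos _)).
by move=> /is_derive_eq1; apply; rewrite /nx /wy [eps * (eps * _)]mulrA eps2; ring.
Qed.

Lemma is_derive_wy (x : R) : is_derive x 1 wy (c * (v x * ny x)).
Proof.
have := is_derive1Z eps (is_derive1Z e (is_derive1_comp (is_derive_arc_angle x) (is_derive_sin _))).
by move=> /is_derive_eq1; apply; rewrite /ny /wx; ring.
Qed.

Lemma is_derive_nx (x : R) : is_derive x 1 nx (- (c * (v x * wx x))).
Proof.
have := is_derive1N (is_derive1Z eps (is_derive_wy x)).
move=> /is_derive_eq1; apply; rewrite /ny.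
rewrite [LHS](_ : _ = - ((eps * eps) * (c * (v x * wx x)))); last by ring.
by rewrite eps2 mul1r.
Qed.

Lemma is_derive_ny (x : R) : is_derive x 1 ny (- (c * (v x * wy x))).
Proof.
have := is_derive1Z eps (is_derive_wx x).
move=> /is_derive_eq1; apply; rewrite /nx.
rewrite [LHS](_ : _ = - ((eps * eps) * (c * (v x * wy x)))); last by ring.
by rewrite eps2 mul1r.
Qed.

Lemma w_unit x : wx x * wx x + wy x * wy x = 1.
Proof.
rewrite /wx /wy [LHS](_ : _ = (e * e) * cos (arc_angle x) ^+ 2 +
  (eps * eps) * (e * e) * sin (arc_angle x) ^+ 2); last by ring.
by rewrite e2 eps2 !mul1r cos2Dsin2.
Qed.

Lemma n_unit x : nx x * nx x + ny x * ny x = 1.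
Proof.
rewrite /nx /ny [LHS](_ : _ = (eps * eps) * (wx x * wx x + wy x * wy x)); last by ring.
by rewrite w_unit eps2 mul1r.
Qed.

Let cwx : continuous wx.
Proof. by apply: derivable1_continuous => x; exact: is_derive1_derivable (is_derive_wx x). Qed.
Let cwy : continuous wy.
Proof. by apply: derivable1_continuous => x; exact: is_derive1_derivable (is_derive_wy x). Qed.
Let cnx : continuous nx.
Proof. by apply: derivable1_continuous => x; exact: is_derive1_derivable (is_derive_nx x). Qed.
Let cny : continuous ny.
Proof. by apply: derivable1_continuous => x; exact: is_derive1_derivable (is_derive_ny x). Qed.
Let cp : continuous p. Proof. exact: xvel_continuous. Qed.
Let cq : continuous q. Proof. exact: yvel_continuous. Qed.
Let cX : continuous X. Proof. exact/derivable1_continuous/(xcoord_C1 imm).1. Qed.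
Let cY : continuous Y. Proof. exact/derivable1_continuous/(ycoord_C1 imm).1. Qed.
Let ct1 : continuous t1. Proof. exact: tau1_continuous. Qed.
Let ct2 : continuous t2. Proof. exact: tau2_continuous. Qed.

Lemma nx_periodic : periodic nx T.
Proof. by move=> x; rewrite /nx wy_periodic. Qed.
Lemma ny_periodic : periodic ny T.
Proof. by move=> x; rewrite /ny wx_periodic. Qed.

Lemma is_derive_perturb_x (t x : R) :
  is_derive x 1 (xcoord (perturb t)) (v x * ux t x).
Proof.
have := is_derive1D (derivable_is_derive1 ((xcoord_C1 imm).1 x))
  (is_derive1Z t (is_derive_wx x)).
move=> /is_derive_eq1; apply; rewrite -/(xvel gamma x) xvel_tau// /ux.
by ring.
Qed.

Lemma is_derive_perturb_y (t x : R) :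
  is_derive x 1 (ycoord (perturb t)) (v x * uy t x).
Proof.
have := is_derive1D (derivable_is_derive1 ((ycoord_C1 imm).1 x))
  (is_derive1Z t (is_derive_wy x)).
move=> /is_derive_eq1; apply; rewrite -/(yvel gamma x) yvel_tau// /uy.
by ring.
Qed.

Lemma xvel_perturb t x : xvel (perturb t) x = v x * ux t x.
Proof. exact: is_derive1_derive1 (is_derive_perturb_x t x). Qed.

Lemma yvel_perturb t x : yvel (perturb t) x = v x * uy t x.
Proof. exact: is_derive1_derive1 (is_derive_perturb_y t x). Qed.

Lemma u_sqr t x : ux t x * ux t x + uy t x * uy t x =
  1 + 2 * (t * c) * (nx x * (tau gamma x).1 + ny x * (tau gamma x).2) + (t * c) ^+ 2.
Proof.
rewrite /ux /uy [LHS](_ : _ =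
  ((tau gamma x).1 * (tau gamma x).1 + (tau gamma x).2 * (tau gamma x).2) +
  2 * (t * c) * (nx x * (tau gamma x).1 + ny x * (tau gamma x).2) +
  (t * c) ^+ 2 * (nx x * nx x + ny x * ny x)); last by ring.
by rewrite tau_unit// n_unit mulr1.
Qed.

Lemma nt_le x : `|nx x * (tau gamma x).1 + ny x * (tau gamma x).2| <= 1.
Proof.
have := n_unit x; have := tau_unit imm x.
move: (nx x) (ny x) (tau gamma x).1 (tau gamma x).2 => a b a' b' ab' ab.
rewrite ler_norml; apply/andP; split.
  by have := sqr_ge0 (a + a'); have := sqr_ge0 (b + b'); nra.
by have := sqr_ge0 (a - a'); have := sqr_ge0 (b - b'); nra.
Qed.

(** * Immersion, winding number and energy of a small perturbation *)

Section small.
Variable t : R.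
Hypotheses (t0 : 0 <= t) (tc1 : t * c < 1).
Local Notation u := (t * c).

Let u0 : 0 <= u. Proof. by rewrite mulr_ge0// ltW. Qed.

(** Holds since the unit vectors n and tau have product at least -1. As [u < 1], the perturbed
    tangent stays within a right angle of the original one, which is what [rotation_eq] asks for to
    preserve the winding number. *)
Lemma dot_u_tau x : 1 - u <= ux t x * (tau gamma x).1 + uy t x * (tau gamma x).2.
Proof.
rewrite /ux /uy [leRHS](_ : _ =
  ((tau gamma x).1 * (tau gamma x).1 + (tau gamma x).2 * (tau gamma x).2) +
  u * (nx x * (tau gamma x).1 + ny x * (tau gamma x).2)); last by ring.
rewrite tau_unit//; have := nt_le x; rewrite ler_norml => /andP[+ _].
move=> /(ler_wpM2l u0); lra.
Qed.

Lemma u_sqr_ge x : (1 - u) ^+ 2 <= ux t x * ux t x + uy t x * uy t x.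
Proof.
rewrite u_sqr; have := nt_le x; rewrite ler_norml => /andP[+ _].
move=> /(ler_wpM2l u0); lra.
Qed.

Lemma u_sqr_gt0 x : 0 < ux t x * ux t x + uy t x * uy t x.
Proof. by apply: lt_le_trans (u_sqr_ge x); rewrite exprn_gt0// subr_gt0. Qed.

Lemma unorm_gt0 x : 0 < unorm t x.
Proof. by rewrite sqrtr_gt0 u_sqr_gt0. Qed.

Lemma unorm_sqr x : unorm t x ^+ 2 = ux t x * ux t x + uy t x * uy t x.
Proof. by rewrite sqr_sqrtr// ltW// u_sqr_gt0. Qed.

Lemma unorm_ge x : 1 - u <= unorm t x.
Proof.
have u1 : 0 <= 1 - u by rewrite subr_ge0 ltW.
by rewrite -(@ler_pXn2r _ 2)// ?nnegrE ?(ltW (unorm_gt0 x))// unorm_sqr u_sqr_ge.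
Qed.

Lemma unorm_le x : unorm t x <= 1 + u.
Proof.
have u1 : 0 <= 1 + u by rewrite addr_ge0.
rewrite -(@ler_pXn2r _ 2)// ?nnegrE ?(ltW (unorm_gt0 x))// unorm_sqr u_sqr.
have := nt_le x; rewrite ler_norml => /andP[_].
move=> /(ler_wpM2l u0); lra.
Qed.

Lemma speed_perturb x : speed (perturb t) x = v x * unorm t x.
Proof.
rewrite speedE xvel_perturb yvel_perturb.
rewrite [X in Num.sqrt X](_ : _ = v x ^+ 2 * (ux t x * ux t x + uy t x * uy t x)); last by ring.
by rewrite sqrtrM ?sqr_ge0// sqrtr_sqr ger0_norm// ltW// speed_gt0.
Qed.

Let H1n : H1on 0 T nx (fun x => - (c * (v x * wx x))) /\
  H1on 0 T ny (fun x => - (c * (v x * wy x))).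
Proof.
split.
  exact: (H1on_is_derive T0 is_derive_nx (continuousNf (continuousZf (continuousMf cv cwx)))).
exact: (H1on_is_derive T0 is_derive_ny (continuousNf (continuousZf (continuousMf cv cwy)))).
Qed.

Lemma H1on_u m : angular_speed gamma m ->
  H1on 0 T (ux t) (fun x => - (m x * (tau gamma x).2) + u * - (c * (v x * wx x))) /\
  H1on 0 T (uy t) (fun x => m x * (tau gamma x).1 + u * - (c * (v x * wy x))).
Proof.
move=> [_ h1 h2]; have [n1 n2] := H1n.
by split; apply: H1onD => //; exact: H1onZ.
Qed.

Lemma perturb_W22Imm : W22Imm (perturb t).
Proof.
have [[v' v1] [m mP]] := angular_speed_exists imm.
have [u1 u2] := H1on_u mP.
have cux : continuous (ux t) by exact: continuousDf ct1 (continuousZf cnx).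
have cuy : continuous (uy t) by exact: continuousDf ct2 (continuousZf cny).
apply: (@W22Imm_of_H1 _ (xcoord (perturb t)) (ycoord (perturb t))).
- by move=> x; rewrite /xcoord/= wx_periodic -!/(xcoord gamma _) xcoord_periodic.
- by move=> x; rewrite /ycoord/= wy_periodic -!/(ycoord gamma _) ycoord_periodic.
- split; first by move=> x; exact: is_derive1_derivable (is_derive_perturb_x t x).
  rewrite (_ : derive1 _ = (fun x => v x * ux t x)); first exact: continuousMf.
  by apply/funext => x; exact: xvel_perturb.
- split; first by move=> x; exact: is_derive1_derivable (is_derive_perturb_y t x).
  rewrite (_ : derive1 _ = (fun x => v x * uy t x)); first exact: continuousMf.
  by apply/funext => x; exact: yvel_perturb.
- by apply: eq_H1on (H1onM T0 v1 u1) => x _ //; rewrite -xvel_perturb.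
- by apply: eq_H1on (H1onM T0 v1 u2) => x _ //; rewrite -yvel_perturb.
- move=> x; rewrite -/(xvel _ x) -/(yvel _ x) xvel_perturb yvel_perturb.
  rewrite [ltRHS](_ : _ = v x ^+ 2 * (ux t x * ux t x + uy t x * uy t x)); last by ring.
  by rewrite mulr_gt0 ?u_sqr_gt0// exprn_gt0// speed_gt0.
Qed.

Lemma tau_perturb x : (tau (perturb t) x).1 = ux t x / unorm t x /\
  (tau (perturb t) x).2 = uy t x / unorm t x.
Proof.
have v0 := lt0r_neq0 (speed_gt0 imm x); have r0 := lt0r_neq0 (unorm_gt0 x).
rewrite /tau/= -!/(xvel _ x) -!/(yvel _ x) xvel_perturb yvel_perturb speed_perturb.
by split; field; rewrite ?v0 ?r0.
Qed.

(** The angular speed is taken from [(ux, uy)] and not from the velocity [v (ux, uy)]: the positive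
    factor [v] does not change the angle, so no derivative of the speed enters. *)
Definition perturbed_angular m (x : R) : R :=
  (ux t x * (m x * (tau gamma x).1 + u * - (c * (v x * wy x))) -
   uy t x * (- (m x * (tau gamma x).2) + u * - (c * (v x * wx x)))) /
  (ux t x * ux t x + uy t x * uy t x).

Lemma perturbed_angular_speed m : angular_speed gamma m ->
  angular_speed (perturb t) (perturbed_angular m).
Proof.
move=> mP; have [u1 u2] := H1on_u mP.
have [_ h1 h2 h3] := H1on_normalize T0 u1 u2 (fun x _ => u_sqr_gt0 x).
split; first exact: h1.
- by apply: eq_H1on h2 => x _; have [E1 E2] := tau_perturb x; rewrite ?E1 ?E2.
- by apply: eq_H1on h3 => x _; have [E1 E2] := tau_perturb x; rewrite ?E1 ?E2.
Qed.

Lemma perturb_winding : winding_number (perturb t) = winding_number gamma.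
Proof.
have [_ [m mP]] := angular_speed_exists imm.
have [u1 u2] := H1on_u mP; have [_ h1 h2] := mP.
rewrite (winding_numberE perturb_W22Imm (perturbed_angular_speed mP)).
rewrite (winding_numberE imm mP); congr (_ * _).
have per (f : R -> R) : periodic f T -> f T = f 0 by exact: periodic_at_period.
have e1 : ux t T = ux t 0.
  by rewrite /ux (per t1 (tau1_periodic imm)) (per nx nx_periodic).
have e2' : uy t T = uy t 0.
  by rewrite /uy (per t2 (tau2_periodic imm)) (per ny ny_periodic).
have dut x : 0 <= x <= T -> 0 < ux t x * t1 x + uy t x * t2 x.
  by move=> _; apply: lt_le_trans (dot_u_tau x); rewrite subr_gt0.
rewrite (rotation_eq u1 u2 h1 h2 e1 e2' (per _ (tau1_periodic imm))
  (per _ (tau2_periodic imm)) dut).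
apply: eq_segint => x _.
rewrite tau_unit// divr1 [RHS](_ : _ = m x * ((tau gamma x).1 * (tau gamma x).1 +
  (tau gamma x).2 * (tau gamma x).2)); last by rewrite tau_unit// mulr1.
by ring.
Qed.

(** The numerator is [m d - u c v k], where [d] and [k] are products of [(ux, uy)] with unit
    vectors, so [d ^+ 2] and [k ^+ 2] are at most the squared norm of [(ux, uy)]. A weighted Young
    inequality separates the two terms. One factor of the squared norm cancels against the
    denominator, and the other is at least [(1 - u) ^+ 2]. *)
Lemma perturbed_angular_sqr m x :
  perturbed_angular m x ^+ 2 <=
  (1 - u)^-1 ^+ 2 * ((1 + u) * (m x ^+ 2 + u * (c * v x) ^+ 2)).
Proof.
have s0 := u_sqr_gt0 x; have s1 := u_sqr_ge x.
have u1 : 0 < 1 - u by rewrite subr_gt0.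
pose d := ux t x * (tau gamma x).1 + uy t x * (tau gamma x).2.
pose k := ux t x * wy x - uy t x * wx x.
rewrite /perturbed_angular [X in X / _](_ : _ = m x * d - u * (c * v x) * k); last first.
  by rewrite /d /k; ring.
have cs (a b a' b' : R) : a' * a' + b' * b' = 1 -> (a * a' + b * b') ^+ 2 <= a * a + b * b.
  move=> E; rewrite -[leRHS]mulr1 -E -subr_ge0.
  by rewrite [leRHS](_ : _ = (a * b' - b * a') ^+ 2) ?sqr_ge0//; ring.
have hd : d ^+ 2 <= ux t x * ux t x + uy t x * uy t x by apply/cs/tau_unit.
have hk : k ^+ 2 <= ux t x * ux t x + uy t x * uy t x.
  rewrite /k -mulrN; apply: cs; rewrite mulrNN addrC; exact: w_unit.
move: (ux t x * ux t x + uy t x * uy t x) s0 s1 hd hk => s s0 s1 hd hk.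
set b := c * v x; move: (m x) d k hd hk => a d k hd hk.
have h1 : (a * d - u * b * k) ^+ 2 <= (1 + u) * (a ^+ 2 * d ^+ 2 + u * (b ^+ 2 * k ^+ 2)).
  rewrite -subr_ge0 [leRHS](_ : _ = u * (a * d + b * k) ^+ 2); last by ring.
  by rewrite mulr_ge0 ?sqr_ge0.
have h2 : (1 + u) * (a ^+ 2 * d ^+ 2 + u * (b ^+ 2 * k ^+ 2)) <=
    (1 + u) * (a ^+ 2 + u * b ^+ 2) * s.
  rewrite -[leRHS]mulrA ler_wpM2l ?addr_ge0// [leRHS]mulrDl lerD//.
    by rewrite ler_wpM2l ?sqr_ge0.
  by rewrite -[leRHS]mulrA ler_wpM2l// ler_wpM2l ?sqr_ge0.
have K0 : 0 <= (1 + u) * (a ^+ 2 + u * b ^+ 2).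
  by apply: mulr_ge0; apply: addr_ge0 => //; [exact: sqr_ge0|exact/mulr_ge0/sqr_ge0].
rewrite expr_div_n ler_pdivrMr ?exprn_gt0//.
apply: le_trans h1 _; apply: le_trans h2 _.
rewrite [leRHS](_ : _ = (1 + u) * (a ^+ 2 + u * b ^+ 2) * s * (s * (1 - u)^-1 ^+ 2)); last by ring.
apply: ler_peMr; first exact: mulr_ge0 K0 (ltW s0).
by rewrite exprVn ler_pdivlMr ?exprn_gt0// mul1r.
Qed.

(** The pointwise bound is divided by the new speed [v * unorm] and integrated; [unorm] is at least
    [1 - u], whence the third power in the denominator, and the integral of [c ^+ 2 * v] is
    [c * T]. *)
Lemma perturb_energy : bending_energy (perturb t) <=
  (1 + u) / (1 - u) ^+ 3 * (bending_energy gamma + u * (c * T)).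
Proof.
have [_ [m mP]] := angular_speed_exists imm.
have mtP := perturbed_angular_speed mP.
rewrite (bending_energyE perturb_W22Imm mtP) (bending_energyE imm mP).
have [_ It] := angular_speed_measurable perturb_W22Imm mtP.
have [_ Im] := angular_speed_measurable imm mP.
have u1 : 0 < 1 - u by rewrite subr_gt0.
have -> : u * (c * T) = segint 0 T (fun x => u * c ^+ 2 * v x).
  rewrite segintZ; last exact: L1on_continuous.
  by rewrite -curve_lengthE// expr2 -[RHS]mulrA -[c * c * L]mulrA cL.
have Iv : L1on 0 T (fun x => u * c ^+ 2 * v x) by exact/L1onZ/L1on_continuous.
rewrite -segintD// -segintZ; last exact: L1onD.
apply: le_segint => //; first by apply: L1onZ; exact: L1onD.
move=> x _; have v0 := speed_gt0 imm x; have r0 := unorm_gt0 x.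
rewrite speed_perturb ler_pdivrMr ?mulr_gt0//.
apply: le_trans (perturbed_angular_sqr m x) _.
have ru : 1 - u <= unorm t x by exact: unorm_ge.
have K0 : 0 <= (1 + u) * (m x ^+ 2 + u * (c * v x) ^+ 2).
  by apply: mulr_ge0; apply: addr_ge0 => //; [exact: sqr_ge0|exact/mulr_ge0/sqr_ge0].
have aux (w V r M C U : R) : w != 0 -> V != 0 ->
    (1 + U) / w ^+ 3 * (M ^+ 2 / V + U * C ^+ 2 * V) * (V * r) =
    w^-1 ^+ 2 * ((1 + U) * (M ^+ 2 + U * (C * V) ^+ 2)) * (r / w).
  by move=> w0 V0; field; rewrite w0 V0.
rewrite aux ?lt0r_neq0//.
apply: ler_peMr; first by apply: mulr_ge0 K0; exact: sqr_ge0.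
by rewrite ler_pdivlMr// mul1r.
Qed.

(** * Length and area of the perturbed curve *)

Lemma unorm_continuous : continuous (unorm t).
Proof.
have cux : continuous (ux t) by exact: continuousDf ct1 (continuousZf cnx).
have cuy : continuous (uy t) by exact: continuousDf ct2 (continuousZf cny).
move=> x.
suff : {for x, continuous (Num.sqrt \o (fun x => ux t x * ux t x + uy t x * uy t x))} by [].
apply: continuous_comp; last exact: sqrt_continuous.
exact: continuousDf (continuousMf cux cux) (continuousMf cuy cuy) x.
Qed.

Let cr := unorm_continuous.

Lemma perturb_lengthE : curve_length (perturb t) = segint 0 T (fun x => v x * unorm t x).
Proof.
by rewrite curve_lengthE; apply: eq_segint => x _; exact: speed_perturb.
Qed.

(** What ties length to area: n is a quarter turn of [w], so the first variation density of the
    length is, up to a constant, that of the flux. *)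
Lemma v_nt x : v x * (nx x * (tau gamma x).1 + ny x * (tau gamma x).2) =
  eps * (wx x * q x - wy x * p x).
Proof.
by rewrite /nx /ny (xvel_tau imm x) (yvel_tau imm x); ring.
Qed.

Let I_flux k : L1on 0 T (fun x => k * (wx x * q x - wy x * p x)).
Proof.
apply: L1on_continuous; apply: continuousZf.
exact: continuousDf (continuousMf cwx cq) (continuousNf (continuousMf cwy cp)).
Qed.

Let I_flux1 : L1on 0 T (fun x => wx x * q x - wy x * p x).
Proof. by apply: eq_L1on (I_flux 1) => x _; rewrite mul1r. Qed.

(** The norm of tau + u n is at least its projection 1 + u n.tau onto tau; this is integrated with
    [v_nt]. *)
Lemma perturb_length_ge : L + u * (eps * flux) <= curve_length (perturb t).
Proof.
rewrite perturb_lengthE [u * (eps * flux)]mulrA [X in X + _ <= _]curve_lengthE -segintZ// -segintD//; last exact: L1on_continuous.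
apply: le_segint.
- by apply: L1onD; [exact: L1on_continuous|exact: I_flux].
- exact/L1on_continuous/continuousMf.
move=> x _; have v0 := ltW (speed_gt0 imm x).
have -> : v x + u * eps * (wx x * q x - wy x * p x) =
    v x * (1 + u * (nx x * (tau gamma x).1 + ny x * (tau gamma x).2)).
  by rewrite [RHS]mulrDr mulr1 [v x * (u * _)]mulrCA v_nt; ring.
have r0 := ltW (unorm_gt0 x); have r2 := unorm_sqr x.
rewrite u_sqr in r2; have := nt_le x; move: r2.
move: (nx x * _ + _) => z r2 z1.
apply: ler_wpM2l => //; have [z0|z0] := leP (1 + u * z) 0; first exact: le_trans z0 r0.
rewrite -(@ler_pXn2r _ 2) ?nnegrE ?(ltW z0)// r2.
have z2 : z ^+ 2 <= 1 by rewrite -[z ^+ 2]real_normK ?num_real// exprn_ile1.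
by have := ler_wpM2l (sqr_ge0 u) z2; lra.
Qed.

(** Cauchy-Schwarz for the arc length measure: the squared new length is at most [L] times the
    integral of [v * unorm ^+ 2], which is computed exactly. It is derived from Young's inequality
    with [k] the mean value of [unorm]. *)
Lemma perturb_length_sqr_le :
  curve_length (perturb t) ^+ 2 <= L ^+ 2 + 2 * (T * t) * (eps * flux) + (T * t) ^+ 2.
Proof.
have lt0 := curve_length_gt0 perturb_W22Imm.
have [k k0 ltE] : exists2 k, 0 < k & curve_length (perturb t) = k * L.
  exists (curve_length (perturb t) / L); first exact: divr_gt0 lt0 L0.
  exact: (esym (divfK (lt0r_neq0 L0) _)).
have I1 : L1on 0 T (fun x => (1 + u ^+ 2 + k ^+ 2) * v x).
  exact/L1on_continuous/continuousZf.
have I2 : L1on 0 T (fun x => v x * unorm t x) by exact/L1on_continuous/continuousMf.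
have : segint 0 T (fun x => (2 * k) * (v x * unorm t x)) <=
    segint 0 T (fun x => (1 + u ^+ 2 + k ^+ 2) * v x +
      (2 * u * eps) * (wx x * q x - wy x * p x)).
  apply: le_segint; [exact: L1onZ|exact: L1onD|].
  move=> x _.
  have -> : (2 * u * eps) * (wx x * q x - wy x * p x) =
    2 * u * (v x * (nx x * (tau gamma x).1 + ny x * (tau gamma x).2)).
    by rewrite v_nt; ring.
  have r2 := unorm_sqr x; rewrite u_sqr in r2.
  rewrite -subr_ge0 [leRHS](_ : _ = v x * (unorm t x ^+ 2 - 2 * k * unorm t x + k ^+ 2)); last first.
    by rewrite r2; ring.
  rewrite mulr_ge0//; first by rewrite ltW// speed_gt0.
  by rewrite [leRHS](_ : _ = (unorm t x - k) ^+ 2) ?sqr_ge0//; ring.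
rewrite segintZ// segintD// segintZ; last exact: L1on_continuous.
rewrite segintZ// -curve_lengthE// -perturb_lengthE ltE -/flux => H.
apply: (@sqr_le_of_young _ k L u eps flux (T * t) L0 _ H).
by rewrite -mulrA cL mulrC.
Qed.

End small.

(** The area is quadratic in the curve. The two mixed terms become equal after integration by parts,
    and the term in [t ^+ 2] is the signed area of [w]. *)
Lemma perturb_areaE t : (t * c < 1) -> 0 <= t ->
  algebraic_area (perturb t) = algebraic_area gamma + t * flux + eps * pi * t ^+ 2.
Proof.
move=> tc1 t0; rewrite (algebraic_areaE (perturb_W22Imm t0 tc1)) (algebraic_areaE imm).
have Ix a b (f : R -> R) : continuous f -> L1on a b f by exact: L1on_continuous.
rewrite (@eq_segint _ _ _ _ (fun x => (X x * q x - Y x * p x) +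
  (t * ((X x * (c * (v x * ny x)) - Y x * (c * (v x * nx x))) + (wx x * q x - wy x * p x)) +
   t ^+ 2 * eps * c * v x))); last first.
  move=> x _; rewrite xvel_perturb yvel_perturb.
  have -> : v x * ux t x = p x + t * (c * (v x * nx x)).
    by rewrite (xvel_tau imm) /ux; ring.
  have -> : v x * uy t x = q x + t * (c * (v x * ny x)).
    by rewrite (yvel_tau imm) /uy; ring.
  have := w_unit x; rewrite /perturb /xcoord /ycoord/= /nx /ny => w1.
  rewrite -[X in _ = _ + (_ + X)]mulr1 -w1; ring.
have c1 : continuous (fun x => X x * q x - Y x * p x).
  exact: continuousDf (continuousMf cX cq) (continuousNf (continuousMf cY cp)).
have c2 : continuous (fun x => wx x * q x - wy x * p x).
  exact: continuousDf (continuousMf cwx cq) (continuousNf (continuousMf cwy cp)).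
have cvn1 : continuous (fun x => c * (v x * nx x)) by exact: continuousZf (continuousMf cv cnx).
have cvn2 : continuous (fun x => c * (v x * ny x)) by exact: continuousZf (continuousMf cv cny).
have cX2 : continuous (fun x => X x * (c * (v x * ny x))) by exact: continuousMf.
have cY1 : continuous (fun x => Y x * (c * (v x * nx x))) by exact: continuousMf.
rewrite (segint_lincomb _ _ (Ix _ _ _ c1) (Ix _ _ _ cX2) (Ix _ _ _ cY1) (Ix _ _ _ c2)
  (Ix _ _ _ cv)).
have per (f : R -> R) : periodic f T -> f T = f 0 by exact: periodic_at_period.
have PX := derive1_primitive T0 (xcoord_C1 imm).
have PY := derive1_primitive T0 (ycoord_C1 imm).
have Pw1 := primitive_is_derive T0 is_derive_wx cvn1.
have Pw2 := primitive_is_derive T0 is_derive_wy cvn2.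
rewrite (segint_by_parts_periodic _ PX Pw2); last first.
  by rewrite (per _ (xcoord_periodic imm)) (per _ wy_periodic).
rewrite (segint_by_parts_periodic _ PY Pw1); last first.
  by rewrite (per _ (ycoord_periodic imm)) (per _ wx_periodic).
rewrite -curve_lengthE// -/flux.
have -> : flux = segint 0 T (fun x => q x * wx x) - segint 0 T (fun x => p x * wy x).
  rewrite -segintB; [|exact: Ix (continuousMf cq cwx)|exact: Ix (continuousMf cp cwy)].
  by apply: eq_segint => x _; ring.
rewrite -!/(xvel gamma) -!/(yvel gamma).
have -> : t ^+ 2 * eps * c * L = t ^+ 2 * eps * T by rewrite -mulrA cL.
by field.
Qed.

(** By the reverse triangle inequality [unorm] is Lipschitz in [t] with constant [c]. This supplies
    the continuity for the intermediate value argument. *)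
Lemma perturb_length_lipschitz s t : 0 <= s -> s * c < 1 -> 0 <= t -> t * c < 1 ->
  `|curve_length (perturb s) - curve_length (perturb t)| <= T * `|s - t|.
Proof.
move=> s0 sc1 t0 tc1; rewrite !perturb_lengthE//.
have cr k : 0 <= k -> k * c < 1 -> L1on 0 T (fun x => v x * unorm k x).
  by move=> k0 kc1; apply/L1on_continuous/continuousMf => //; exact: unorm_continuous.
rewrite -segintB; [|exact: cr|exact: cr].
have -> : T * `|s - t| = (c * `|s - t|) * segint 0 T v.
  by rewrite -curve_lengthE// [RHS]mulrAC cL.
apply: norm_segint_le.
- by apply: L1onB; exact: cr.
- exact: L1on_continuous.
move=> x _; have v0 := speed_gt0 imm x.
rewrite -mulrBr normrM gtr0_norm// [leLHS]mulrC; apply: ler_wpM2r; first exact: ltW.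
have rs := ltW (unorm_gt0 s0 sc1 x); have rt := ltW (unorm_gt0 t0 tc1 x).
have E := unorm_sqr s0 sc1 x; have E' := unorm_sqr t0 tc1 x.
rewrite u_sqr in E; rewrite u_sqr in E'; have z1 := nt_le x.
apply: le_trans (dist_of_sqr rs rt E E' z1) _.
by rewrite -mulrBl normrM [`|c|]gtr0_norm// mulrC.
Qed.

End perturbation.

(** * Bounds on the energy profile *)

Section scaling.
Context {R : realType}.
Local Notation T := (2 * @pi R).
Variables (gamma : R -> R * R) (r : R).
Hypotheses (imm : W22Imm gamma) (r0 : 0 < r).

Let T0 : 0 <= T. Proof. exact/ltW/twopi_gt0. Qed.

Definition scale (x : R) : R * R := (r * xcoord gamma x, r * ycoord gamma x).

Lemma xvel_scale x : xvel scale x = r * xvel gamma x.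
Proof.
apply: is_derive1_derive1; apply: is_derive1Z.
exact/derivable_is_derive1/(xcoord_C1 imm).1.
Qed.

Lemma yvel_scale x : yvel scale x = r * yvel gamma x.
Proof.
apply: is_derive1_derive1; apply: is_derive1Z.
exact/derivable_is_derive1/(ycoord_C1 imm).1.
Qed.

Lemma C1_scale (f : R -> R) : C1 f -> C1 (fun x => r * f x).
Proof.
move=> [df cf'].
have E (x : R) : is_derive x (1 : R) (fun x : R => r * f x : R) (r * derive1 f x).
  exact/is_derive1Z/derivable_is_derive1.
split; first by move=> x; exact: is_derive1_derivable (E x).
rewrite (_ : derive1 _ = (fun x => r * derive1 f x)); first exact: continuousZf.
by apply/funext => x; exact: is_derive1_derive1 (E x).
Qed.

Lemma speed_scale x : speed scale x = r * speed gamma x.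
Proof.
rewrite !speedE xvel_scale yvel_scale.
rewrite (_ : r * _ * _ + _ = r ^+ 2 * (xvel gamma x * xvel gamma x + yvel gamma x * yvel gamma x)); last by ring.
by rewrite sqrtrM ?sqr_ge0// sqrtr_sqr gtr0_norm.
Qed.

Lemma scale_W22Imm : W22Imm scale.
Proof.
have [sX sY cX cY _] := imm.
have [g1 g12 g1P] := sobolev2_primitive cX sX.
have [g2 g22 g2P] := sobolev2_primitive cY sY.
apply: (@W22Imm_of_H1 _ (xcoord scale) (ycoord scale) (fun x => r * g1 x) (fun x => r * g2 x)).
- by move=> x; rewrite /xcoord/= -!/(xcoord gamma _) xcoord_periodic.
- by move=> x; rewrite /ycoord/= -!/(ycoord gamma _) ycoord_periodic.
- exact: C1_scale.
- exact: C1_scale.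
- by apply: eq_H1on (H1onZ r T0 (conj g12 g1P)) => x _ //; exact: (esym (xvel_scale x)).
- by apply: eq_H1on (H1onZ r T0 (conj g22 g2P)) => x _ //; exact: (esym (yvel_scale x)).
- move=> x; rewrite -/(xvel _ x) -/(yvel _ x) xvel_scale yvel_scale.
  rewrite (_ : r * _ * _ + _ = r ^+ 2 * (xvel gamma x * xvel gamma x + yvel gamma x * yvel gamma x)); last by ring.
  by rewrite mulr_gt0 ?exprn_gt0// vel_gt0.
Qed.

Lemma tau_scale x : tau scale x = tau gamma x.
Proof.
have v0 := lt0r_neq0 (speed_gt0 imm x); have rn := lt0r_neq0 r0.
rewrite /tau/= -!/(xvel _ x) -!/(yvel _ x) xvel_scale yvel_scale speed_scale.
by congr pair; field; rewrite v0 rn.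
Qed.

Lemma angular_speed_scale m : angular_speed gamma m -> angular_speed scale m.
Proof.
move=> [m2 h1 h2]; split; first exact: m2.
- by apply: eq_H1on h1 => x _; rewrite tau_scale.
- by apply: eq_H1on h2 => x _; rewrite tau_scale.
Qed.

Lemma scale_length : curve_length scale = r * curve_length gamma.
Proof.
rewrite !curve_lengthE -segintZ; last exact/L1on_continuous/speed_continuous.
by apply: eq_segint => x _; exact: speed_scale.
Qed.

Lemma scale_area : algebraic_area scale = r ^+ 2 * algebraic_area gamma.
Proof.
rewrite (algebraic_areaE scale_W22Imm) (algebraic_areaE imm) mulrCA; congr (_ * _).
rewrite -segintZ.
  by apply: eq_segint => x _; rewrite xvel_scale yvel_scale /xcoord /ycoord/=; ring.
have cX : continuous (xcoord gamma) := derivable1_continuous (xcoord_C1 imm).1.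
have cY : continuous (ycoord gamma) := derivable1_continuous (ycoord_C1 imm).1.
apply: L1on_continuous; apply: continuousDf; last apply: continuousNf.
  exact: continuousMf cX (yvel_continuous imm).
exact: continuousMf cY (xvel_continuous imm).
Qed.

Lemma scale_winding : winding_number scale = winding_number gamma.
Proof.
have [_ [m mP]] := angular_speed_exists imm.
by rewrite (winding_numberE imm mP) (winding_numberE scale_W22Imm (angular_speed_scale mP)).
Qed.

Lemma scale_energy : bending_energy scale = bending_energy gamma / r.
Proof.
have [_ [m mP]] := angular_speed_exists imm.
have [_ Im] := angular_speed_measurable imm mP.
rewrite (bending_energyE imm mP) (bending_energyE scale_W22Imm (angular_speed_scale mP)).
rewrite [RHS]mulrC -segintZ//; apply: eq_segint => x _; rewrite speed_scale.
have v0 := lt0r_neq0 (speed_gt0 imm x); have rn := lt0r_neq0 r0.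
by field; rewrite v0 rn.
Qed.

End scaling.

(** * Reaching a prescribed length by perturbing and rescaling *)

Section energy_profile.
Context {R : realType}.
Local Notation T := (2 * @pi R).
Implicit Types (gamma : R -> R * R) (e eps l t : R).

Definition normal_immersion gamma : Prop := W22Imm gamma /\ winding_number gamma = 1.

Lemma energy_profile_ge0 l : (0 <= energy_profile l)%E.
Proof.
apply: le_ereal_inf_tmp => _ [gamma [imm _ _ _] <-].
by rewrite lee_fin bending_energy_ge0.
Qed.

Lemma energy_profile_le gamma l : normal_immersion gamma -> 0 < l ->
  pi * curve_length gamma ^+ 2 = l ^+ 2 * algebraic_area gamma ->
  (energy_profile l <= (bending_energy gamma * curve_length gamma / l)%:E)%E.
Proof.
move=> [imm w1] l0 E; have L0 := curve_length_gt0 imm.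
have r0 : 0 < l / curve_length gamma by rewrite divr_gt0.
apply: ereal_inf_lbound; exists (scale gamma (l / curve_length gamma)).
  split; first exact: scale_W22Imm.
  - by rewrite scale_winding.
  - rewrite scale_area// expr_div_n mulrAC -E mulfK//.
    by rewrite expf_neq0// lt0r_neq0.
  - by rewrite scale_length// divfK// lt0r_neq0.
by rewrite scale_energy// invf_div mulrA.
Qed.

Lemma energy_profile_approx l (y : R) : (energy_profile l < y%:E)%E ->
  exists gamma, [/\ normal_immersion gamma, algebraic_area gamma = pi,
    curve_length gamma = l & bending_energy gamma < y].
Proof.
move=> /ereal_inf_lt[_ [gamma [imm w a le] <-]]; rewrite lte_fin => ey.
by exists gamma.
Qed.

Lemma perturb0 gamma (e eps : R) : perturb gamma e eps 0 = gamma.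
Proof.
apply/funext => x; rewrite /perturb !mul0r !addr0 /xcoord /ycoord/=.
by case: (gamma x).
Qed.

Lemma flux_opp gamma e eps : W22Imm gamma -> e * e = 1 -> eps * eps = 1 ->
  flux gamma (- e) eps = - flux gamma e eps.
Proof.
move=> imm e2 eps2; rewrite /flux -segintN.
  by apply: eq_segint => x _; rewrite /wx /wy; ring.
have cw (f : R -> R) f' : (forall x : R, is_derive x 1 f (f' x)) -> continuous f.
  by move=> df; apply: derivable1_continuous => x; exact: is_derive1_derivable (df x).
have c1 := continuousMf (cw _ _ (is_derive_wx e imm eps2)) (yvel_continuous imm).
have c2 := continuousMf (cw _ _ (is_derive_wy e eps imm)) (xvel_continuous imm).
exact: (L1on_continuous _ _ (continuousDf c1 (continuousNf c2))).
Qed.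

(** Changing [e] into [- e] replaces [w] by its opposite and the flux by its negative. *)
Lemma flux_sign gamma eps : W22Imm gamma -> eps * eps = 1 ->
  exists2 e, e * e = 1 & 0 <= eps * flux gamma e eps.
Proof.
move=> imm eps2; have [h|h] := leP 0 (eps * flux gamma 1 eps).
  by exists 1 => //; rewrite mulr1.
exists (-1); first by rewrite mulrNN mulr1.
by rewrite flux_opp ?mulr1// mulrN oppr_ge0 ltW.
Qed.

Lemma perturb_length_le gamma e eps t : W22Imm gamma -> e * e = 1 -> eps * eps = 1 ->
  0 <= t -> t * (T / curve_length gamma) < 1 ->
  curve_length (perturb gamma e eps t) <=
  (1 + t * (T / curve_length gamma)) * curve_length gamma.
Proof.
move=> imm e2 eps2 t0 tc1; rewrite perturb_lengthE// [X in _ <= _ * X]curve_lengthE.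
have cv := speed_continuous imm.
rewrite -segintZ; last exact: L1on_continuous.
apply: le_segint.
- by apply/L1on_continuous/continuousMf => //; exact: unorm_continuous.
- exact/L1on_continuous/continuousZf.
move=> x _; rewrite [leRHS]mulrC ler_wpM2l ?unorm_le//.
by rewrite ltW// speed_gt0.
Qed.

(* Bounds energy times length, a scale invariant quantity, along the perturbation
   of relative size u of a curve with energy times length equal to k. *)
Definition perturb_bound (u k : R) : R :=
  (1 + u) ^+ 2 / (1 - u) ^+ 3 * (k + u * T ^+ 2).

Lemma perturb_bound_le u u' k : 0 <= k -> 0 <= u -> u <= u' -> u' < 1 ->
  perturb_bound u k <= perturb_bound u' k.
Proof.
move=> k0 u0 uu u1; have u1' : u < 1 by exact: le_lt_trans u1.
rewrite /perturb_bound ler_pM//.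
- by rewrite divr_ge0 ?sqr_ge0// exprn_ge0// subr_ge0 ltW.
- by rewrite addr_ge0// mulr_ge0// sqr_ge0.
- rewrite ler_pM ?sqr_ge0//; first by rewrite invr_ge0 exprn_ge0// subr_ge0 ltW.
    by rewrite lerXn2r ?nnegrE; lra.
  rewrite lef_pV2 ?posrE ?exprn_gt0 ?subr_gt0//.
  by rewrite lerXn2r ?nnegrE; lra.
- by rewrite lerD2l ler_wpM2r// sqr_ge0.
Qed.

Lemma perturb_energy_length gamma e eps t : W22Imm gamma -> e * e = 1 -> eps * eps = 1 ->
  0 <= t -> t * (T / curve_length gamma) < 1 ->
  bending_energy (perturb gamma e eps t) * curve_length (perturb gamma e eps t) <=
  perturb_bound (t * (T / curve_length gamma)) (bending_energy gamma * curve_length gamma).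
Proof.
move=> imm e2 eps2 t0 tc1; have L0 := curve_length_gt0 imm.
have immt := perturb_W22Imm imm e2 eps2 t0 tc1.
apply: le_trans (ler_pM _ _ (perturb_energy imm e2 eps2 t0 tc1)
  (perturb_length_le imm e2 eps2 t0 tc1)) _.
- exact: bending_energy_ge0.
- exact/ltW/curve_length_gt0.
rewrite le_eqVlt; apply/orP; left; apply/eqP.
have aux (u w E L S : R) : L != 0 -> (1 + u) / w * (E + u * (S / L * S)) * ((1 + u) * L) =
  (1 + u) ^+ 2 / w * (E * L + u * S ^+ 2).
  move=> L00; have <- : (E + u * (S / L * S)) * L = E * L + u * S ^+ 2 by field.
  by ring.
by rewrite aux ?lt0r_neq0.
Qed.

Lemma perturb_length_within_continuous gamma e eps t :
  W22Imm gamma -> e * e = 1 -> eps * eps = 1 -> t * (T / curve_length gamma) < 1 ->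
  {within `[0, t], continuous (fun s => curve_length (perturb gamma e eps s))}.
Proof.
move=> imm e2 eps2 tc1; have T0 := twopi_gt0 (R := R).
have c0 : 0 < T / curve_length gamma by rewrite divr_gt0// curve_length_gt0.
apply/subspace_continuousP => s /=; rewrite in_itv/= => /andP[s0 st].
have sc s' : s' <= t -> s' * (T / curve_length gamma) < 1.
  by move=> h; apply: le_lt_trans tc1; rewrite ler_wpM2r// ltW.
apply/cvgrPdist_lt => d d0; rewrite near_withinE; near=> s'.
rewrite /= in_itv/= => /andP[s'0 s't].
apply: le_lt_trans (perturb_length_lipschitz imm e2 eps2 s0 (sc _ st) s'0 (sc _ s't)) _.
rewrite mulrC -ltr_pdivlMr//.
by near: s'; exists (d / T) => //=; exact: divr_gt0.
Unshelve. all: by end_near. Qed.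

(** The intermediate value theorem applies to [pi * L ^+ 2 - l ^+ 2 * A] along the perturbation; a
    zero at some [s <= t] is a curve that rescales to length [l] and area pi. Its energy bound is at
    most the one at [t] by monotonicity. *)
Lemma perturb_to_ratio gamma e eps t l : normal_immersion gamma ->
  e * e = 1 -> eps * eps = 1 -> 0 <= t -> t * (T / curve_length gamma) < 1 -> 0 < l ->
  (pi * curve_length gamma ^+ 2 <= l ^+ 2 * algebraic_area gamma /\
   l ^+ 2 * algebraic_area (perturb gamma e eps t) <=
   pi * curve_length (perturb gamma e eps t) ^+ 2) \/
  (l ^+ 2 * algebraic_area gamma <= pi * curve_length gamma ^+ 2 /\
   pi * curve_length (perturb gamma e eps t) ^+ 2 <=
   l ^+ 2 * algebraic_area (perturb gamma e eps t)) ->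
  (energy_profile l <= (perturb_bound (t * (T / curve_length gamma))
     (bending_energy gamma * curve_length gamma) / l)%:E)%E.
Proof.
move=> [imm w1] e2 eps2 t0 tc1 l0 ft'.
have [f fE] : exists f : R -> R, forall s,
    f s = pi * curve_length (perturb gamma e eps s) ^+ 2 -
      l ^+ 2 * algebraic_area (perturb gamma e eps s) by eexists.
have ft : Num.min (f 0) (f t) <= 0 <= Num.max (f 0) (f t).
  have f0 : f 0 = pi * curve_length gamma ^+ 2 - l ^+ 2 * algebraic_area gamma.
    by rewrite fE perturb0.
  case: ft' => -[h0 ht].
    have f00 : f 0 <= 0.
      rewrite f0.
      rewrite subr_le0.
      exact: h0.
    have ft0 : 0 <= f t by rewrite fE subr_ge0; exact: ht.
    by rewrite ge_min le_max f00 ft0 orbT.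
  have f00 : 0 <= f 0 by rewrite f0 subr_ge0; exact: h0.
  have ft0 : f t <= 0 by rewrite fE subr_le0; exact: ht.
  by rewrite ge_min le_max f00 ft0 orbT.
have L0 := curve_length_gt0 imm; have c0 : 0 < T / curve_length gamma by rewrite divr_gt0 ?twopi_gt0.
have sc s' : s' <= t -> s' * (T / curve_length gamma) < 1.
  by move=> h; apply: le_lt_trans tc1; rewrite ler_wpM2r// ltW.
have cf : {within `[0, t], continuous f}.
  (* The area formula holds only for the admissible [s], so continuity is shown for this explicit
     expression, equal to [f] on the segment. *)
  pose g s := pi * (curve_length (perturb gamma e eps s) * curve_length (perturb gamma e eps s)) -
    l ^+ 2 * (algebraic_area gamma + s * flux gamma e eps + eps * pi * (s * s)).
  have gf s : 0 <= s -> s <= t -> g s = f s.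
    move=> s0 st; rewrite fE /g (perturb_areaE imm e2 eps2 (sc _ st) s0).
    by rewrite [s ^+ 2]expr2 [curve_length _ ^+ 2]expr2.
  apply: (@subspace_eq_continuous _ _ _ g).
    by move=> s; rewrite inE/= in_itv/= => /andP[s0 st]; exact: gf.
  have cL := perturb_length_within_continuous imm e2 eps2 tc1.
  have cst (k : R) : continuous (fun _ : R => k) by move=> s; exact: cvg_cst.
  have cid : continuous (fun s : R => s : R) by move=> s; exact: cvg_id.
  have cA : {within `[0, t], continuous (fun s => algebraic_area gamma +
      s * flux gamma e eps + eps * pi * (s * s))}.
    exact: continuous_subspaceT (continuousDf (continuousDf (cst _)
      (continuousMf cid (cst _))) (continuousMf (cst _) (continuousMf cid cid))).
  move=> s; apply: cvgB; apply: cvgM; [exact: cvg_cst| |exact: cvg_cst|exact: cA].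
  by apply: cvgM; exact: cL.
have [s] := IVT t0 cf ft; rewrite in_itv/= => /andP[s0 st] /eqP.
rewrite fE subr_eq0 => /eqP fs.
have imms := perturb_W22Imm imm e2 eps2 s0 (sc _ st).
apply: le_trans (energy_profile_le _ l0 fs) _.
  split; first exact: imms.
  by rewrite (perturb_winding imm e2 eps2 s0 (sc _ st)); exact: w1.
rewrite lee_fin; apply: ler_wpM2r; first by rewrite invr_ge0 ltW.
apply: le_trans (perturb_energy_length imm e2 eps2 s0 (sc _ st)) _.
apply: perturb_bound_le => //.
- by rewrite mulr_ge0 ?bending_energy_ge0// ltW.
- by rewrite mulr_ge0// ltW.
- by rewrite ler_wpM2r// ltW.
Qed.

(** The case eps = -1, with [p] for pi and [F] for the flux: the length does not decrease, and the
    area loses at least [p * t ^+ 2]. *)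
Lemma lengthen_ratio (p l t L A F Lt u : R) : 0 <= p -> 0 <= t -> 0 <= u -> 0 <= L ->
  0 <= -1 * F -> l ^+ 2 * (A - p * t ^+ 2) <= p * L ^+ 2 -> L + u * (-1 * F) <= Lt ->
  l ^+ 2 * (A + t * F + -1 * p * t ^+ 2) <= p * Lt ^+ 2.
Proof.
move=> p0 t0 u0 L0 F0 H Llt.
have LLt : L <= Lt by apply: le_trans Llt; rewrite lerDl mulr_ge0.
have h1 : L ^+ 2 <= Lt ^+ 2 by rewrite lerXn2r ?nnegrE// (le_trans L0).
have h2 := ler_wpM2l p0 h1.
have h3 : 0 <= l ^+ 2 * (t * (-1 * F)) := mulr_ge0 (sqr_ge0 l) (mulr_ge0 t0 F0).
by move: H h2 h3; clear; lra.
Qed.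

(** The case eps = 1: the defect [L ^+ 2 - 4 * p * A] does not grow, while the area gains at least
    [p * t ^+ 2]. The conclusion says that [p] times the new defect is at most
    [l ^+ 2 - (2 * p) ^+ 2] times the new area. *)
Lemma shorten_ratio (p l t L A F Lt : R) : 0 <= p -> 0 <= t -> 2 * p <= l ->
  0 <= 1 * F ->
  p * (L ^+ 2 - 4 * p * A) <= (l ^+ 2 - (2 * p) ^+ 2) * (A + p * t ^+ 2) ->
  Lt ^+ 2 <= L ^+ 2 + 2 * (2 * p * t) * (1 * F) + (2 * p * t) ^+ 2 ->
  p * Lt ^+ 2 <= l ^+ 2 * (A + t * F + 1 * p * t ^+ 2).
Proof.
move=> p0 t0 pl F0 H Llt; have h2 := ler_wpM2l p0 Llt.
have p20 : 0 <= 2 * p by exact: mulr_ge0.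
have h3 : 0 <= (l ^+ 2 - (2 * p) ^+ 2) * (t * (1 * F)).
  apply: mulr_ge0; last exact: mulr_ge0 t0 F0.
  by rewrite subr_ge0 lerXn2r ?nnegrE// (le_trans p20).
by move: H h2 h3; clear; lra.
Qed.

(* Adding a small circle traversed backwards decreases the area, and adding one
   traversed forwards increases the isoperimetric defect at most by that of the
   circle; both for a suitable choice of the phase e. *)
Lemma energy_profile_lengthen gamma t l : normal_immersion gamma ->
  0 <= t -> t * (T / curve_length gamma) < 1 -> 0 < l ->
  pi * curve_length gamma ^+ 2 <= l ^+ 2 * algebraic_area gamma ->
  l ^+ 2 * (algebraic_area gamma - pi * t ^+ 2) <= pi * curve_length gamma ^+ 2 ->
  (energy_profile l <= (perturb_bound (t * (T / curve_length gamma))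
     (bending_energy gamma * curve_length gamma) / l)%:E)%E.
Proof.
move=> ni t0 tc1 l0 h0 ht; have [imm _] := ni; have L0 := curve_length_gt0 imm.
have eps2 : (-1) * (-1) = 1 :> R by rewrite mulrNN mulr1.
have [e e2 fe] := flux_sign imm eps2.
apply: (perturb_to_ratio ni e2 eps2 t0 tc1 l0).
left; split; first exact: h0.
have c0 : 0 <= t * (T / curve_length gamma).
  by apply: mulr_ge0 t0 (divr_ge0 (ltW (twopi_gt0 (R := R))) (ltW L0)).
have Lt := perturb_length_ge imm e2 eps2 t0 tc1.
rewrite (perturb_areaE imm e2 eps2 tc1 t0).
exact: lengthen_ratio (pi_ge0 R) t0 c0 (ltW L0) fe ht Lt.
Qed.

Lemma energy_profile_shorten gamma t l : normal_immersion gamma ->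
  0 <= t -> t * (T / curve_length gamma) < 1 -> T <= l ->
  l ^+ 2 * algebraic_area gamma <= pi * curve_length gamma ^+ 2 ->
  pi * (curve_length gamma ^+ 2 - 4 * pi * algebraic_area gamma) <=
    (l ^+ 2 - T ^+ 2) * (algebraic_area gamma + pi * t ^+ 2) ->
  (energy_profile l <= (perturb_bound (t * (T / curve_length gamma))
     (bending_energy gamma * curve_length gamma) / l)%:E)%E.
Proof.
move=> ni t0 tc1 Tl h0 ht; have [imm _] := ni; have L0 := curve_length_gt0 imm.
have eps2 : 1 * 1 = 1 :> R by rewrite mulr1.
have l0 : 0 < l by apply: lt_le_trans Tl; exact: twopi_gt0.
have [e e2 fe] := flux_sign imm eps2.
apply: (perturb_to_ratio ni e2 eps2 t0 tc1 l0).
right; split; first exact: h0.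
have Lt := perturb_length_sqr_le imm e2 eps2 t0 tc1.
rewrite (perturb_areaE imm e2 eps2 tc1 t0).
exact: shorten_ratio (pi_ge0 R) t0 Tl fe ht Lt.
Qed.

End energy_profile.

(** * The circle and a Lissajous curve *)

Section explicit_curves.
Context {R : realType}.
Local Notation T := (2 * @pi R).
Implicit Types (x : R).

Let T0 : 0 <= T. Proof. exact/ltW/twopi_gt0. Qed.

Lemma angular_speed_of_H1 (gamma : R -> R * R) (a b : R -> R) : W22Imm gamma ->
  H1on 0 T (xvel gamma) a -> H1on 0 T (yvel gamma) b ->
  angular_speed gamma (fun x => (xvel gamma x * b x - yvel gamma x * a x) /
    (xvel gamma x * xvel gamma x + yvel gamma x * yvel gamma x)).
Proof.
move=> imm h1 h2.
have [_ m2 m3 m4] := H1on_normalize T0 h1 h2 (fun x _ => vel_gt0 imm x).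
by split; [exact: m2|exact: m3|exact: m4].
Qed.

Section twice_differentiable.
Variables X Y p q a b : R -> R.
Hypotheses (XT : periodic X T) (YT : periodic Y T).
Hypotheses (dX : forall x, is_derive x 1 X (p x)) (dY : forall x, is_derive x 1 Y (q x)).
Hypotheses (dp : forall x, is_derive x 1 p (a x)) (dq : forall x, is_derive x 1 q (b x)).
Hypotheses (ca : continuous a) (cb : continuous b).
Hypothesis pq0 : forall x, 0 < p x * p x + q x * q x.

Let X'E : derive1 X = p. Proof. by apply/funext => x; exact: is_derive1_derive1 (dX x). Qed.
Let Y'E : derive1 Y = q. Proof. by apply/funext => x; exact: is_derive1_derive1 (dY x). Qed.

Let C1_of (f f' f'' : R -> R) : (forall x, is_derive x 1 f (f' x)) ->
  (forall x, is_derive x 1 f' (f'' x)) -> C1 f.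
Proof.
move=> df df'; split; first by move=> x; exact: is_derive1_derivable (df x).
rewrite (_ : derive1 f = f'); last by apply/funext => x; exact: is_derive1_derive1 (df x).
by apply: derivable1_continuous => x; exact: is_derive1_derivable (df' x).
Qed.

Lemma W22Imm_C2 : W22Imm (fun x => (X x, Y x)).
Proof.
apply: (@W22Imm_of_H1 _ X Y a b) => //.
- exact: C1_of dX dp.
- exact: C1_of dY dq.
- by rewrite X'E; exact: H1on_is_derive.
- by rewrite Y'E; exact: H1on_is_derive.
- by rewrite X'E Y'E.
Qed.

Lemma angular_speed_C2 : angular_speed (fun x => (X x, Y x))
  (fun x => (p x * b x - q x * a x) / (p x * p x + q x * q x)).
Proof.
rewrite -X'E -Y'E; apply: angular_speed_of_H1; first exact: W22Imm_C2.
  by rewrite [xvel _]X'E; exact: H1on_is_derive.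
by rewrite [yvel _]Y'E; exact: H1on_is_derive.
Qed.

Lemma speed_C2 x : speed (fun x => (X x, Y x)) x = Num.sqrt (p x * p x + q x * q x).
Proof. by rewrite speedE -X'E -Y'E. Qed.

Lemma area_C2 : algebraic_area (fun x => (X x, Y x)) =
  1 / 2 * segint 0 T (fun x => X x * q x - Y x * p x).
Proof. by rewrite (algebraic_areaE W22Imm_C2) -X'E -Y'E. Qed.

End twice_differentiable.

Lemma periodic_cos : periodic (@cos R) T.
Proof. by move=> x; rewrite mulr_natl cosD2pi. Qed.

Lemma periodic_sin : periodic (@sin R) T.
Proof. by move=> x; rewrite mulr_natl sinD2pi. Qed.

Lemma is_derive_Nsin x : is_derive x 1 (fun x => - sin x : R) (- cos x).
Proof. by apply: is_derive1N; exact: is_derive_sin. Qed.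

Lemma sin2_cos2 x : sin x * sin x + cos x * cos x = 1 :> R.
Proof. by rewrite addrC -!expr2 cos2Dsin2. Qed.

Let cNcos : continuous (fun x => - cos x : R).
Proof. exact/continuousNf/continuous_cos. Qed.
Let cNsin : continuous (fun x => - sin x : R).
Proof. exact/continuousNf/continuous_sin. Qed.

(** The velocity of an ellipse has positive product with that of the unit circle, so both turn by
    the same angle. Used as an intermediate field for the Lissajous curve. *)
Lemma circle_rotation (k : R) : 0 < k ->
  segint 0 T (fun x => (- sin x * (k * - sin x) - k * cos x * - cos x) /
    (- sin x * - sin x + k * cos x * (k * cos x))) = T.
Proof.
move=> k0.
have h1 : H1on 0 T (fun x => - sin x : R) (fun x => - cos x).
  exact: H1on_is_derive is_derive_Nsin cNcos.
have h2 : H1on 0 T (@cos R) (fun x => - sin x).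
  by apply: H1on_is_derive cNsin => // x; exact: is_derive_cos.
have h3 := H1onZ k T0 h2.
have sT : - sin T = - sin 0 :> R by rewrite (periodic_at_period periodic_sin).
have cT : cos T = cos 0 :> R by exact: periodic_at_period periodic_cos.
have kcT : k * cos T = k * cos 0 by rewrite cT.
rewrite (rotation_eq h1 h3 h1 h2 sT kcT sT cT).
  rewrite (@eq_segint _ _ _ _ (fun=> 1)) ?segint_cst ?subr0 ?mul1r// => x _.
  rewrite mulrNN sin2_cos2 divr1 [LHS](_ : _ = sin x * sin x + cos x * cos x).
    exact: sin2_cos2.
  by ring.
move=> x _; rewrite mulrNN; have := sin2_cos2 x.
have [c0|c0] := eqVneq (cos x) 0; first by rewrite c0 !mulr0 !addr0 => ->.
move=> _; rewrite ltr_wpDl ?[X in 0 <= X]mulr_ge0//; first by rewrite -expr2 sqr_ge0.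
by rewrite -mulrA mulr_gt0// -expr2 exprn_even_gt0.
Qed.

Definition circle (x : R) : R * R := (cos x, sin x).

Let circle_pq0 x : 0 < - sin x * - sin x + cos x * cos x.
Proof. by rewrite mulrNN sin2_cos2. Qed.

Let dcos x : is_derive x 1 (@cos R) (- sin x). Proof. exact: is_derive_cos. Qed.
Let dsin x : is_derive x 1 (@sin R) (cos x). Proof. exact: is_derive_sin. Qed.

Lemma circle_W22Imm : W22Imm circle.
Proof.
exact: (W22Imm_C2 periodic_cos periodic_sin dcos dsin is_derive_Nsin dcos cNcos cNsin circle_pq0).
Qed.

Let circle_angular : angular_speed circle (fun=> 1).
Proof.
have := angular_speed_C2 periodic_cos periodic_sin dcos dsin is_derive_Nsin dcos cNcos cNsin circle_pq0.
rewrite (_ : (fun x => _ / _) = (fun=> 1))//; apply/funext => x.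
rewrite mulrNN sin2_cos2 divr1 [LHS](_ : _ = sin x * sin x + cos x * cos x).
  exact: sin2_cos2.
by ring.
Qed.

Let circle_speed x : speed circle x = 1.
Proof. by rewrite (speed_C2 dcos dsin) mulrNN sin2_cos2 sqrtr1. Qed.

Lemma circle_normal : normal_immersion circle.
Proof.
split; first exact: circle_W22Imm.
rewrite (winding_numberE circle_W22Imm circle_angular) segint_cst// subr0 mul1r.
by rewrite mulVf// lt0r_neq0// twopi_gt0.
Qed.

Lemma circle_length : curve_length circle = T.
Proof.
rewrite curve_lengthE (@eq_segint _ _ _ _ (fun=> 1)) ?segint_cst ?subr0 ?mul1r//.
Qed.

Lemma circle_area : algebraic_area circle = pi.
Proof.
rewrite (area_C2 periodic_cos periodic_sin dcos dsin is_derive_Nsin dcos cNcos cNsin circle_pq0).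
rewrite (@eq_segint _ _ _ _ (fun=> 1)) ?segint_cst// ?subr0; first by field.
by move=> x _; rewrite -[RHS](sin2_cos2 x); ring.
Qed.

Lemma circle_energy : bending_energy circle = T.
Proof.
rewrite (bending_energyE circle_W22Imm circle_angular).
rewrite (@eq_segint _ _ _ _ (fun=> 1)) ?segint_cst ?subr0 ?mul1r// => x _.
by rewrite circle_speed expr1n divr1.
Qed.

(* The Lissajous curve (cos x, sin 3x): its lobes have areas a, -2a, a. *)
Definition lissajous (x : R) : R * R := (cos x, sin x * (4 * (cos x * cos x) - 1)).

(** [lx], [lq] and [lb] are sin 3x and its first two derivatives 3 cos 3x and -9 sin 3x, as
    polynomials in [cos x] and [sin x]. *)
Let lx (x : R) : R := sin x * (4 * (cos x * cos x) - 1).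
Let lq (x : R) : R := 12 * (cos x * (cos x * cos x)) - 9 * cos x.
Let lb (x : R) : R := 9 * sin x - 36 * (sin x * (cos x * cos x)).

Let dlx x : is_derive x 1 lx (lq x).
Proof.
have := is_derive1M (dsin x) (is_derive1B (is_derive1Z 4 (is_derive1M (dcos x) (dcos x)))
  (is_derive_cst (1 : R) x 1)).
move=> /is_derive_eq1; apply; rewrite /lq.
have s2 : sin x * sin x = 1 - cos x * cos x by rewrite -(sin2_cos2 x); ring.
rewrite [LHS](_ : _ = cos x * (4 * (cos x * cos x) - 1) - 8 * (sin x * sin x) * cos x).
  by rewrite s2; ring.
by rewrite /=; ring.
Qed.

Let dlq x : is_derive x 1 lq (lb x).
Proof.
have := is_derive1B (is_derive1Z 12 (is_derive1M (dcos x) (is_derive1M (dcos x) (dcos x))))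
  (is_derive1Z 9 (dcos x)).
by move=> /is_derive_eq1; apply; rewrite /lb; ring.
Qed.

Let clb : continuous lb.
Proof.
have c := @continuous_cos R; have s := @continuous_sin R.
exact: continuousDf (continuousZf s) (continuousNf (continuousZf (continuousMf s (continuousMf c c)))).
Qed.

(** Compares the Lissajous velocity with that of an ellipse. The weight 1/9 makes the product 1 - 2
    C + (4/3) C^2 with C = cos^2 x, and completing the square bounds it below by 1/4. *)
Let lq_dot x : 0 < - sin x * - sin x + lq x * (9^-1 * cos x).
Proof.
have s2 : sin x * sin x = 1 - cos x * cos x by rewrite -(sin2_cos2 x); ring.
rewrite mulrNN s2 /lq.
rewrite [ltRHS](_ : _ = 1 / 4 + (4 / 3) * (cos x * cos x - 3 / 4) ^+ 2); last by field.
by rewrite ltr_wpDr// mulr_ge0// sqr_ge0.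
Qed.

Let lpq0 x : 0 < - sin x * - sin x + lq x * lq x.
Proof.
have h := lq_dot x; rewrite lt0r addr_ge0 -?expr2 ?sqr_ge0// andbT.
rewrite paddr_eq0 ?sqr_ge0// !expf_eq0/=; apply/negP => /andP[/eqP s0 /eqP q0].
by move: h; rewrite s0 q0 !mul0r addr0 ltxx.
Qed.

Let lxT : periodic lx T.
Proof. by move=> x; rewrite /lx periodic_sin periodic_cos. Qed.

Lemma lissajous_W22Imm : W22Imm lissajous.
Proof.
exact: (W22Imm_C2 periodic_cos lxT dcos dlx is_derive_Nsin dlq cNcos clb lpq0).
Qed.

Lemma lissajous_normal : normal_immersion lissajous.
Proof.
split; first exact: lissajous_W22Imm.
have lang := angular_speed_C2 periodic_cos lxT dcos dlx is_derive_Nsin dlq cNcos clb lpq0.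
rewrite (winding_numberE lissajous_W22Imm lang).
have h1 : H1on 0 T (fun x => - sin x : R) (fun x => - cos x).
  exact: H1on_is_derive is_derive_Nsin cNcos.
have h2 : H1on 0 T lq lb by exact: H1on_is_derive dlq clb.
have h3 := H1onZ 9^-1 T0 (H1on_is_derive T0 dcos cNsin).
have sT : - sin T = - sin 0 :> R by rewrite (periodic_at_period periodic_sin).
have cT : 9^-1 * cos T = 9^-1 * cos 0 :> R by rewrite (periodic_at_period periodic_cos).
have qT : lq T = lq 0 by rewrite /lq (periodic_at_period periodic_cos).
rewrite (rotation_eq h1 h2 h1 h3 sT qT sT cT (fun x _ => lq_dot x)) circle_rotation//.
by rewrite mulVf// lt0r_neq0// twopi_gt0.
Qed.

Lemma lissajous_area : algebraic_area lissajous = 0.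
Proof.
rewrite (area_C2 periodic_cos lxT dcos dlx is_derive_Nsin dlq cNcos clb lpq0).
(* [F] is sin 2x + (sin 4x) / 4, a periodic antiderivative of the area integrand [f], which is 2 cos
   2x + cos 4x. *)
pose F x : R := 2 * (cos x * (cos x * (cos x * sin x))) + cos x * sin x.
pose f x : R := cos x * lq x - lx x * - sin x.
have dF x : is_derive x 1 F (f x).
  have := is_derive1D (is_derive1Z 2 (is_derive1M (dcos x) (is_derive1M (dcos x)
    (is_derive1M (dcos x) (dsin x))))) (is_derive1M (dcos x) (dsin x)).
  move=> /is_derive_eq1; apply; rewrite /f /lq /lx.
  have s2 : sin x * sin x = 1 - cos x * cos x by rewrite -(sin2_cos2 x); ring.
  rewrite [RHS](_ : _ = cos x * (12 * (cos x * (cos x * cos x)) - 9 * cos x) +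
    (sin x * sin x) * (4 * (cos x * cos x) - 1)); last by ring.
  rewrite [LHS](_ : _ = 2 * (cos x * (cos x * (cos x * cos x))) -
    (6 * cos x * cos x + 1) * (sin x * sin x) + cos x * cos x); last by ring.
  by rewrite s2; ring.
have cf : continuous f.
  have c := @continuous_cos R; have s := @continuous_sin R.
  have clq : continuous lq by apply: derivable1_continuous => x; exact: is_derive1_derivable (dlq x).
  have clx : continuous lx by apply: derivable1_continuous => x; exact: is_derive1_derivable (dlx x).
  exact: continuousDf (continuousMf c clq) (continuousNf (continuousMf clx cNsin)).
have [_ /(_ 0 T (lexx _) T0 (lexx _))] := primitive_is_derive T0 dF cf.
rewrite /F (periodic_at_period periodic_cos) (periodic_at_period periodic_sin) subrr.
by move=> <-; rewrite mulr0.
Qed.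

End explicit_curves.

(** * The energy profile *)

Section profile.
Context {R : realType}.
Local Notation T := (2 * @pi R).
Implicit Types (l k u : R).

Let T0 : 0 < T. Proof. exact: twopi_gt0. Qed.

Lemma perturb_bound_small (K eta : R) : 0 <= K -> 0 < eta -> exists u : R,
  [/\ 0 < u, u < 1 & forall k, 0 <= k <= K -> perturb_bound u k <= k + eta].
Proof.
(* For [u <= 1 / 10] the prefactor is at most [1 + 40 * u], and then the excess of the bound over
   [k] is at most [u * D]. *)
move=> K0 eta0; pose D := 40 * K + 5 * T ^+ 2.
have D0 : 0 < D by rewrite ltr_wpDl ?mulr_ge0// mulr_gt0// exprn_gt0.
pose u := Num.min (1 / 10) (eta / D).
have u10 : u <= 1 / 10 by rewrite ge_min lexx.
have uD : u * D <= eta by rewrite -ler_pdivlMr// ge_min lexx orbT.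
have u0 : 0 < u by rewrite lt_min !divr_gt0.
exists u; split => //; first by lra.
move=> k /andP[k0 kK].
have u2 := sqr_ge0 u.
have u3 : u * u ^+ 2 <= 1 / 10 * u ^+ 2 by rewrite ler_wpM2r.
have u1 : 0 < 1 - u by lra.
have g1 : (1 + u) ^+ 2 / (1 - u) ^+ 3 <= 1 + 40 * u.
  rewrite ler_pdivrMr; last exact: exprn_gt0.
  have h : 0 <= u * (35 - 118 * u + 119 * u ^+ 2 - 40 * (u * u ^+ 2)).
    by apply: mulr_ge0; [exact: ltW|lra].
  rewrite -subr_ge0; apply: le_trans h _; rewrite le_eqVlt; apply/orP; left.
  by apply/eqP; ring.
have kT : 0 <= k + u * T ^+ 2 by rewrite addr_ge0// mulr_ge0 ?(ltW u0)// sqr_ge0.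
apply: le_trans (ler_wpM2r kT g1) _.
have h1 : u * k <= u * K by rewrite ler_wpM2l// ltW.
have h2 : u * (u * T ^+ 2) <= 1 / 10 * (u * T ^+ 2).
  by rewrite ler_wpM2r// mulr_ge0 ?(ltW u0)// sqr_ge0.
move: uD; rewrite /D; lra.
Qed.

Lemma energy_profile_lt_pinfty l : T <= l -> (energy_profile l < +oo)%E.
Proof.
move=> Tl; have l0 : 0 < l by exact: lt_le_trans Tl.
(* With this [t] the circle, pushed backwards, meets the last condition of [energy_profile_lengthen]
   with equality. *)
pose t := Num.sqrt (1 - (T / l) ^+ 2).
have Tl1 : T / l <= 1 by rewrite ler_pdivrMr// mul1r.
have Tl0 : 0 < T / l by rewrite divr_gt0.
have t2 : t ^+ 2 = 1 - (T / l) ^+ 2.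
  by rewrite sqr_sqrtr// subr_ge0 exprn_ile1// ltW.
have t1 : t < 1.
  rewrite -[ltRHS]sqrtr1 ltr_sqrt ?ltr01// gtrBl exprn_gt0//.
have c1 : T / curve_length (@circle R) = 1 by rewrite circle_length divff// lt0r_neq0.
have := @energy_profile_lengthen R (@circle R) t l circle_normal (sqrtr_ge0 _).
rewrite c1 mulr1 circle_length circle_area => /(_ t1 l0) H.
apply: le_lt_trans (H _ _) _; last exact: ltry.
  by rewrite mulrC ler_wpM2r ?pi_ge0// lerXn2r ?nnegrE ?(ltW T0) ?(ltW l0).
rewrite t2 le_eqVlt; apply/orP; left; apply/eqP.
by field; exact: lt0r_neq0.
Qed.

Lemma energy_profile_fin_num l : T <= l -> energy_profile l \is a fin_num.
Proof.
by move=> /energy_profile_lt_pinfty ?; rewrite ge0_fin_numE ?energy_profile_ge0.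
Qed.

(** The least value of the scale invariant product of energy and length. The default value of [fine]
    is harmless for [T <= l], where the profile is finite. *)
Definition scaled_energy l : R := l * fine (energy_profile l).

Lemma scaled_energy_ge0 l : T <= l -> 0 <= scaled_energy l.
Proof.
move=> Tl; rewrite mulr_ge0 ?fine_ge0 ?energy_profile_ge0//.
by apply: le_trans Tl; exact: ltW.
Qed.

Lemma scaled_energy_le l k : T <= l -> (energy_profile l <= (k / l)%:E)%E ->
  scaled_energy l <= k.
Proof.
move=> Tl; have l0 : 0 < l by exact: lt_le_trans Tl.
rewrite -(fineK (energy_profile_fin_num Tl)) lee_fin ler_pdivlMr//.
by rewrite mulrC.
Qed.

(** Cauchy-Schwarz: the square of [m - k * v], divided by [v], is integrated with [k = T / L] the
    mean curvature, [m] having integral [T]. *)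
Lemma winding1_energy_ge (gamma : R -> R * R) : normal_immersion gamma ->
  T ^+ 2 / curve_length gamma <= bending_energy gamma.
Proof.
move=> [imm w1]; have [_ [m mP]] := angular_speed_exists imm.
have L0 := curve_length_gt0 imm; have [_ Im2] := angular_speed_measurable imm mP.
have Im : L1on 0 T m by case: mP => /L2on_L1.
have Iv : L1on 0 T (speed gamma) by exact/L1on_continuous/speed_continuous.
have mT : segint 0 T m = T.
  move: w1; rewrite (winding_numberE imm mP) => /(canRL (mulVKf (lt0r_neq0 T0))).
  by rewrite mulr1.
pose k := T / curve_length gamma.
have -> : T ^+ 2 / curve_length gamma =
    segint 0 T (fun x => 2 * k * m x - k ^+ 2 * speed gamma x).
  rewrite segintB; [|exact: L1onZ|exact: L1onZ].
  rewrite segintZ// segintZ// mT -curve_lengthE /k.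
  by field; exact: lt0r_neq0.
rewrite (bending_energyE imm mP); apply: le_segint => //.
  by apply: L1onB; exact: L1onZ.
move=> x _; have v0 := speed_gt0 imm x.
rewrite ler_pdivlMr// -subr_ge0 [leRHS](_ : _ = (m x - k * speed gamma x) ^+ 2) ?sqr_ge0//.
by ring.
Qed.

Lemma scaled_energy_approx l (eta : R) : T <= l -> 0 < eta ->
  exists gamma, [/\ normal_immersion gamma, algebraic_area gamma = pi,
    curve_length gamma = l &
    bending_energy gamma * curve_length gamma <= scaled_energy l + eta].
Proof.
move=> Tl eta0; have l0 : 0 < l by exact: lt_le_trans Tl.
have [|gamma [ni a lg eg]] := @energy_profile_approx R l (fine (energy_profile l) + eta / l).
  rewrite -{1}(fineK (energy_profile_fin_num Tl)) lte_fin ltrDl divr_gt0//.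
exists gamma; split => //; rewrite lg.
apply: le_trans (ler_wpM2r (ltW l0) (ltW eg)) _.
by rewrite /scaled_energy mulrDl divfK ?lt0r_neq0// mulrC.
Qed.

Lemma scaled_energy_ge l : T <= l -> T ^+ 2 <= scaled_energy l.
Proof.
move=> Tl; apply/ler_addgt0Pr => eta eta0.
have [gamma [ni _ lg]] := scaled_energy_approx Tl eta0; apply: le_trans.
by rewrite -ler_pdivrMr ?winding1_energy_ge// curve_length_gt0//; case: ni.
Qed.

Lemma scaled_energy_T : scaled_energy T = T ^+ 2.
Proof.
apply/le_anti; rewrite scaled_energy_ge// andbT.
apply: scaled_energy_le => //.
have := @energy_profile_le R _ T circle_normal T0.
rewrite circle_length circle_area circle_energy mulrC => /(_ erefl).
by rewrite expr2.
Qed.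

(* The estimate is uniform over the sublevel set, so that l and l' can be
   exchanged: this gives both lower and upper semicontinuity. *)
Lemma scaled_energy_step (K eta : R) : 0 < K -> 0 < eta -> exists u : R,
  [/\ 0 < u, u < 1 & forall l l', T <= l -> T <= l' -> scaled_energy l < K ->
    l' ^+ 2 * (1 - u ^+ 2) <= l ^+ 2 ->
    l ^+ 2 - T ^+ 2 <= (l' ^+ 2 - T ^+ 2) * (1 + u ^+ 2) ->
    scaled_energy l' <= scaled_energy l + eta].
Proof.
move=> K0 eta0; have eta20 : 0 < eta / 2 by rewrite divr_gt0.
have [u [u0 u1 Hu]] := perturb_bound_small (addr_ge0 (ltW K0) (ltW eta20)) eta20.
exists u; split => // l l' Tl Tl' lK h1 h2.
have l0 : 0 < l by exact: lt_le_trans Tl.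
have l'0 : 0 < l' by exact: lt_le_trans Tl'.
have [gamma [ni a lg eg]] := scaled_energy_approx Tl eta20.
have [imm _] := ni.
(* The perturbation has relative size exactly [u], and [u <= t] because [T <= l], so the hypotheses
   stated with [u] imply those needed with [t]. *)
pose t := u * (l / T).
have t0 : 0 <= t := mulr_ge0 (ltW u0) (divr_ge0 (ltW l0) (ltW T0)).
have tu : t * (T / l) = u.
  rewrite /t -mulrA [l / T * _]mulrA (divfK (lt0r_neq0 T0)).
  by rewrite (divff (lt0r_neq0 l0)) mulr1.
have ut2 : u ^+ 2 <= t ^+ 2.
  rewrite lerXn2r ?nnegrE ?(ltW u0)//.
  by rewrite /t ler_peMr ?(ltW u0)// ler_pdivlMr// mul1r.
have tc1 : t * (T / curve_length gamma) < 1 by rewrite lg tu.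
have k0 : 0 <= bending_energy gamma * curve_length gamma.
  by rewrite mulr_ge0 ?bending_energy_ge0// lg ltW.
have bound : perturb_bound u (bending_energy gamma * curve_length gamma) <=
    scaled_energy l + eta.
  apply: le_trans (Hu _ _) _; first by rewrite k0 (le_trans eg)// lerD2r ltW.
  by move: eg; lra.
rewrite lg in bound; have pi0 := pi_ge0 R.
have [ll'|/ltW l'l] := leP l l'.
  apply: scaled_energy_le => //.
  have := @energy_profile_lengthen R gamma t l' ni t0 tc1 l'0.
  rewrite lg a tu => H; apply: le_trans (H _ _) _.
  - by rewrite mulrC ler_wpM2r// lerXn2r ?nnegrE ?(ltW l0) ?(ltW l'0).
  - rewrite (_ : l' ^+ 2 * (pi - pi * t ^+ 2) = pi * (l' ^+ 2 * (1 - t ^+ 2))); last by ring.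
    rewrite ler_wpM2l// (le_trans _ h1)// ler_wpM2l ?sqr_ge0//.
    by rewrite lerD2l lerN2.
  - by rewrite lee_fin; apply: ler_wpM2r bound; rewrite invr_ge0 ltW.
apply: scaled_energy_le => //.
have := @energy_profile_shorten R gamma t l' ni t0 tc1 Tl'.
rewrite lg a tu => H; apply: le_trans (H _ _) _.
- by rewrite mulrC ler_wpM2l// lerXn2r ?nnegrE ?(ltW l0) ?(ltW l'0).
- rewrite (_ : l ^+ 2 - 4 * pi * pi = l ^+ 2 - T ^+ 2); last by ring.
  rewrite (_ : _ * (pi + _) = pi * ((l' ^+ 2 - T ^+ 2) * (1 + t ^+ 2))); last by ring.
  rewrite ler_wpM2l// (le_trans h2)// ler_wpM2l ?lerD2l//.
  by rewrite subr_ge0 lerXn2r ?nnegrE ?(ltW T0) ?(ltW l'0).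
- by rewrite lee_fin; apply: ler_wpM2r bound; rewrite invr_ge0 ltW.
Qed.

Lemma near_sqr_le (a b c d l0 : R) : a * l0 ^+ 2 + b < c * l0 ^+ 2 + d ->
  \forall l \near l0, a * l ^+ 2 + b <= c * l ^+ 2 + d.
Proof.
move=> h; pose f l := (c * (l * l) + d) + - (a * (l * l) + b).
have cf : continuous f.
  have cst (k : R) : continuous (fun _ : R => k) by move=> s; exact: cvg_cst.
  have cid : continuous (fun s : R => s : R) by move=> s; exact: cvg_id.
  have c2 := continuousMf cid cid.
  exact: continuousDf (continuousDf (continuousZf c2) (cst _))
    (continuousNf (continuousDf (continuousZf c2) (cst _))).
have f0 : 0 < f l0 by rewrite /f -!expr2 subr_gt0.
have := cf l0 => /cvgr_gt /(_ _ f0); apply: filterS => l /ltW.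
by rewrite /f -!expr2 subr_ge0.
Qed.

Lemma scaled_energy_continuous (l0 : R) : T <= l0 ->
  scaled_energy l @[l --> within [set l | T <= l] (nbhs l0)] --> scaled_energy l0.
Proof.
move=> Tl0; have l00 : 0 < l0 by exact: lt_le_trans Tl0.
have l20 : 0 < l0 ^+ 2 by rewrite exprn_gt0.
apply/cvgrPdist_le => eta eta0; rewrite near_withinE.
(* The extra 1 keeps [scaled_energy l] below [K] once it is at most [scaled_energy l0 + eta], so
   that the step also applies from [l] back to [l0]. *)
pose K := scaled_energy l0 + eta + 1.
have K0 : 0 < K by rewrite ltr_wpDl// addr_ge0 ?scaled_energy_ge0// ltW.
have [u [u0 u1 Hu]] := scaled_energy_step K0 eta0.
have u20 : 0 < u ^+ 2 by rewrite exprn_gt0.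
have lT : 0 <= l0 ^+ 2 - T ^+ 2 by rewrite subr_ge0 lerXn2r ?nnegrE ?(ltW T0) ?(ltW l00).
have n1 : \forall l \near l0, l ^+ 2 * (1 - u ^+ 2) <= l0 ^+ 2.
  have /near_sqr_le : (1 - u ^+ 2) * l0 ^+ 2 + 0 < 0 * l0 ^+ 2 + l0 ^+ 2.
    by have := mulr_gt0 u20 l20; lra.
  by apply: filterS => l; rewrite mul0r add0r addr0 mulrC.
have n2 : \forall l \near l0, l0 ^+ 2 * (1 - u ^+ 2) <= l ^+ 2.
  have /near_sqr_le : 0 * l0 ^+ 2 + l0 ^+ 2 * (1 - u ^+ 2) < 1 * l0 ^+ 2 + 0.
    by have := mulr_gt0 u20 l20; lra.
  by apply: filterS => l; rewrite mul0r add0r addr0 mul1r.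
(* At the left end the step from [l] back to [T] would require [l ^+ 2 - T ^+ 2 <= 0]. The lower
   bound comes instead from the circle: [T ^+ 2] is the least value of the scaled energy. *)
have [El0|nl0] := eqVneq l0 T.
  near=> l => /= Tl.
  have -> : scaled_energy l0 = T ^+ 2 by rewrite El0 scaled_energy_T.
  have ge := scaled_energy_ge Tl.
  have le : scaled_energy l <= scaled_energy l0 + eta.
    apply: Hu => //.
    - by rewrite /K -addrA ltrDl addr_gt0.
    - by near: l.
    - rewrite El0 subrr mulr_ge0//; last by rewrite addr_ge0// ltW.
      by rewrite subr_ge0 lerXn2r ?nnegrE ?(ltW T0)// (le_trans (ltW T0)).
  rewrite El0 scaled_energy_T in le.
  by rewrite ler_norml; apply/andP; split; lra.
have lT0 : 0 < l0 ^+ 2 - T ^+ 2.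
  rewrite subr_gt0 ltrXn2r// ?nnegrE ?(ltW T0) ?(ltW l00)//.
  by rewrite lt_neqAle eq_sym nl0.
have uT := mulr_gt0 u20 lT0.
have n3 : \forall l \near l0, l ^+ 2 - T ^+ 2 <= (l0 ^+ 2 - T ^+ 2) * (1 + u ^+ 2).
  have /near_sqr_le : 1 * l0 ^+ 2 + - T ^+ 2 < 0 * l0 ^+ 2 + (l0 ^+ 2 - T ^+ 2) * (1 + u ^+ 2).
    by lra.
  by apply: filterS => l; rewrite mul0r add0r mul1r.
have n4 : \forall l \near l0, l0 ^+ 2 - T ^+ 2 <= (l ^+ 2 - T ^+ 2) * (1 + u ^+ 2).
  have /near_sqr_le : 0 * l0 ^+ 2 + (l0 ^+ 2 - T ^+ 2) <
      (1 + u ^+ 2) * l0 ^+ 2 + - T ^+ 2 * (1 + u ^+ 2) by lra.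
  by apply: filterS => l; rewrite mul0r add0r => /le_trans; apply; lra.
near=> l => /= Tl.
have le1 : scaled_energy l <= scaled_energy l0 + eta.
  apply: Hu => //; [|by near: l|by near: l].
  by rewrite /K -addrA ltrDl addr_gt0.
have le2 : scaled_energy l0 <= scaled_energy l + eta.
  apply: Hu => //; [|by near: l|by near: l].
  by rewrite (le_lt_trans le1)// /K ltrDl.
by rewrite ler_norml; apply/andP; split; lra.
Unshelve. all: by end_near. Qed.

Lemma scaled_energy_bounded : exists B l1 : R, forall l, l1 <= l -> scaled_energy l <= B.
Proof.
pose g := @lissajous R; have ni : normal_immersion g := lissajous_normal.
have L0 : 0 < curve_length g by exact: curve_length_gt0 ni.1.
have area0 : algebraic_area g = 0 by exact: lissajous_area.
have [L LE] : exists L : R, curve_length g = L by eexists.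
rewrite LE in L0.
(* Relative size 1/2, independent of [l], so one energy bound serves every large [l]. *)
pose t := L / (2 * T).
have t0 : 0 < t by rewrite divr_gt0// mulr_gt0.
have tc : t * (T / L) = 1 / 2.
  have aux (a b : R) : a != 0 -> b != 0 -> b / (2 * a) * (a / b) = 1 / 2.
    by move=> a0 b0; field; rewrite a0 b0.
  by apply: aux; exact: lt0r_neq0.
(* Beyond [l1] one has [L ^+ 2 <= (l ^+ 2 - T ^+ 2) * t ^+ 2], the condition of
   [energy_profile_shorten] for a curve of area zero. *)
pose l1 := T + L / t.
exists (perturb_bound (1 / 2) (bending_energy g * L)), l1 => l l1l.
have Lt0 : 0 < L / t by rewrite divr_gt0.
have Tl : T <= l by apply: le_trans l1l; rewrite lerDl ltW.
apply: scaled_energy_le => //.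
have := @energy_profile_shorten R g t l ni (ltW t0).
rewrite LE tc area0 => H; apply: H => //; first by lra.
  by rewrite mulr0 mulr_ge0 ?pi_ge0// sqr_ge0.
rewrite mulr0 subr0 add0r [leRHS]mulrCA; apply: ler_wpM2l; first exact: pi_ge0.
have h1 : (T + L / t) ^+ 2 <= l ^+ 2.
  by rewrite lerXn2r ?nnegrE// ?addr_ge0 ?(ltW T0) ?(ltW Lt0)// (le_trans (ltW T0)).
have h2 := mulr_gt0 T0 Lt0.
have h3 : (L / t) ^+ 2 <= l ^+ 2 - T ^+ 2 by move: h1 h2; lra.
rewrite -[X in X ^+ 2 <= _](divfK (lt0r_neq0 t0)) exprMn.
by apply: ler_wpM2r h3; exact: sqr_ge0.
Qed.

End profile.

Theorem theorem5p8 (R : realType) :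
  [/\ (forall l : R, (2 * pi <= l)%R ->
        (0 <= energy_profile l)%E /\ (energy_profile l < +oo)%E),
      {within [set l : R | (2 * pi <= l)%R], continuous (@energy_profile R)} &
      @energy_profile R l @[l --> +oo%R] --> (0%E : \bar R)].
Proof.
have T0 := twopi_gt0 (R := R).
split.
- by move=> l Tl; split; [exact: energy_profile_ge0|exact: energy_profile_lt_pinfty].
- apply/subspace_continuousP => l0 /= Tl0.
  suff : energy_profile l @[l --> within [set l | 2 * pi <= l] (nbhs l0)] -->
      (fine (energy_profile l0))%:E by rewrite fineK// energy_profile_fin_num.
  apply/fine_cvgP; split.
    by rewrite near_withinE; apply: nearW => l; exact: energy_profile_fin_num.
  have l00 : l0 != 0 by rewrite lt0r_neq0// (lt_le_trans T0).
  (* Continuity passes from the scaled energy to the profile through division by the nonzero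
     length. *)
  have -> : fine (energy_profile l0) = scaled_energy l0 * l0^-1.
    by rewrite /scaled_energy mulrC mulKf.
  have : scaled_energy l * l^-1 @[l --> within [set l | 2 * pi <= l] (nbhs l0)] -->
      scaled_energy l0 * l0^-1.
    apply: cvgM; first exact: scaled_energy_continuous.
    by apply: cvgV => //; exact: cvg_within.
  apply: cvg_trans; apply: near_eq_cvg; rewrite near_withinE; apply: nearW => l Tl /=.
  have ln0 : l != 0 by rewrite lt0r_neq0// (lt_le_trans T0).
  by rewrite /scaled_energy [LHS]mulrC mulKf.
- apply/fine_cvgP; split.
    by near=> l; apply: energy_profile_fin_num; near: l; exact/nbhs_pinfty_ge/num_real.
  (* Bounded scaled energy means that the profile is at most [B / l] for large [l]. *)
  have [B [l1 HB]] := scaled_energy_bounded (R := R).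
  apply/cvgrPdist_le => eta eta0; near=> l.
  have l1l : l1 <= l by near: l; exact/nbhs_pinfty_ge/num_real.
  have Tl : 2 * pi <= l by near: l; exact/nbhs_pinfty_ge/num_real.
  have Bl : B / eta <= l by near: l; exact/nbhs_pinfty_ge/num_real.
  have l0 : 0 < l by exact: lt_le_trans Tl.
  rewrite sub0r normrN ger0_norm ?fine_ge0 ?energy_profile_ge0//.
  rewrite -(ler_pM2l l0) (le_trans (HB _ l1l))//.
  by rewrite -ler_pdivrMr.
Unshelve. all: by end_near. Qed.
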